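(* For all integers $p,q>1$, \begin{align*} &(1-(-1)^{p+q})T_{1p,q}\\ &=-(-1)^p(1+(-1)^q)\widetilde{t}(p)T_{1,q}-(-1)^p\widetilde{t}(p)\widetilde{t}(q+1)-T_{1,p+q}-T_{p,q+1}-(-1)^{p+q}\widetilde{t}(p+q+1)\\ &\quad+(1+(-1)^{p+q})2\log(2)\widetilde{t}(p+q)-2\sum_{\substack{2k_1+k_2=p+q\\ k_1,k_2\geq 1}} \widetilde{t}(2k_1)\zeta(k_2+1)\\ &\quad+(-1)^p 2 \sum_{\substack{2k_1+k_2=q+2\\ k_1,k_2\geq 1}} \binom{k_2+p-2}{p-1} \widetilde{t}(2k_1)\zeta(k_2+p-1)+(-1)^p4\log(2)\sum_{\substack{2k_1+k_2=q+1\\ k_1,k_2\geq 1}} \binom{k_2+p-2}{p-1} \widetilde{t}(2k_1)\zeta(k_2+p-1)\\ &\quad-(-1)^p 2 \sum_{\substack{2k_1+k_2+k_3=q+1\\ k_1,k_2\geq 1}}\binom{k_3+p-2}{p-1} \widetilde{t}(2k_1)\zeta(k_2+1)\zeta(k_3+p-1)\\ &\quad+(-1)^p \sum_{l=0}^p ((-1)^l-1) \binom{p+q-l-1}{q-1} \widetilde{t}(l+1)\zeta(p+q-l)\\ &\quad-(-1)^p \sum_{l=0}^{p-1} ((-1)^l-1) \binom{p+q-l-2}{q-1}\widetilde{t}(l+1)\left( S_{1,p+q-l-1}+2\log(2)\zeta(p+q-l-1)\right)\\ &\quad+(-1)^p \sum_{k=1}^{p-1} (-1)^{k+1} \sum_{l=0}^{p-k-1}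 ((-1)^l-1) \binom{p+q-k-l-2}{q-1} \widetilde{t}(l+1) \left((-1)^kS_{k+1,p+q-k-l-1}-\zeta(k+1)\zeta(p+q-k-l-1) \right). \end{align*}
   Context: Let $h_n^{(p)}=\sum_{k=1}^n (k-1/2)^{-p}$ for $n\ge0$, $h_n=h_n^{(1)}$. Euler $T$-sums: $T_{p,q}=\sum_{n\ge1}\frac{h_{n-1}^{(p)}}{(n-1/2)^q}$ and $T_{1p,q}=\sum_{n\ge1}\frac{h_{n-1}h_{n-1}^{(p)}}{(n-1/2)^q}$. Classical Euler sums: $S_{p,q}=\sum_{n\ge1}\frac{H_n^{(p)}}{n^q}$ with $H_n^{(p)}=\sum_{k=1}^n k^{-p}$. $\widetilde t(s)=\sum_{n\ge1}(n-1/2)^{-s}=(2^s-1)\zeta(s)$ for $s>1$; $\zeta$ is the Riemann zeta function. In the sum with $k_3$, $k_3$ ranges over positive integers; terms involving $\widetilde t(1)$ occur only with coefficient $0$. *)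

(* Defs.v *)
From mathcomp Require Import all_boot all_order all_algebra.
From mathcomp Require Import classical_sets reals topology normedtype sequences.
From mathcomp Require Import exp.

Set Implicit Arguments.
Unset Strict Implicit.
Unset Printing Implicit Defensive.

Import Order.TTheory GRing.Theory Num.Theory.
Import numFieldNormedType.Exports.

Local Open Scope ring_scope.

Local Open Scope classical_set_scope.

(* An infinite sum over n >= 1 is [limn (series u)] where [u n] is the term of
   index [n.+1]. It is meaningful only when the series converges: s > 1 for
   [zeta R s] and [ttilde R s], q > 1 for the Euler sums. *)

Definition zeta (R : realType) (s : nat) : R :=
  limn (series (fun n => (n.+1%:R : R) ^- s)).

Definition ttilde (R : realType) (s : nat) : R :=
  limn (series (fun n => (n.+1%:R - 2^-1 : R) ^- s)).

Definition Hnum (R : realType) (p n : nat) : R :=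
  \sum_(1 <= k < n.+1) (k%:R : R) ^- p.

Definition hnum (R : realType) (p n : nat) : R :=
  \sum_(1 <= k < n.+1) (k%:R - 2^-1 : R) ^- p.

Definition EulerS (R : realType) (p q : nat) : R :=
  limn (series (fun n => Hnum R p n.+1 / n.+1%:R ^+ q)).

(* With the shifted index the numerator h_{n-1}^{(p)} becomes [hnum R p n]. *)
Definition EulerT (R : realType) (p q : nat) : R :=
  limn (series (fun n => hnum R p n / (n.+1%:R - 2^-1) ^+ q)).

(* [EulerT1 R p q] is the quadratic sum T_{1p,q}. *)
Definition EulerT1 (R : realType) (p q : nat) : R :=
  limn (series (fun n => hnum R 1 n * hnum R p n / (n.+1%:R - 2^-1) ^+ q)).

(* Main.v *)
Require Import Defs.
From mathcomp Require Import all_boot all_order all_algebra.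
From mathcomp Require Import boolp classical_sets reals topology normedtype sequences.
From mathcomp Require Import exp.
From mathcomp Require Import ring lra zify.

Set Implicit Arguments.
Unset Strict Implicit.
Unset Printing Implicit Defensive.

Import Order.TTheory GRing.Theory Num.Theory.
Import numFieldNormedType.Exports.

Local Open Scope ring_scope.

(** Sum a kernel over all half-integers in two ways.  For [p], [q] fixed put
    [B_N(s) = h_{N+1} + sum_(k <= N) 1 / (s - k)], [D_N(s) = sum_(k <= N) (s - k)^-p]
    and [G_N = s^-q * B_N * D_N].  At the half-integers [+-(n + 1/2)] the functions
    [B_N] and [D_N] tend to shifted harmonic numbers, so summing [G_N] over the
    half-integers produces the Euler T-sums in the limit.  On the other hand [G_N] is
    a rational function with poles [0, ..., N] which vanishes at infinity, hence the
    sum of its principal parts, and a pole [(s - c)^-m] at an integer [c] contributes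
    [tau m = (1 + (-1)^m) ttilde m] to the sum over half-integers, whatever [c] is.
    The principal parts at [n >= 1] produce the Euler S-sums, the one at [0] the
    products of zeta values; [2 log 2] is the limit of [h_N - H_N].  Both sides pass
    to the limit in [N] by Tannery's theorem. *)

(** [B_N] truncates a digamma-type function, and the constant [h_{N+1}] is chosen for convergence:
    at [-(n + 1/2)] the bare sum of poles is [-(h_{n+N+1} - h_n)], so adding [h_{N+1}] leaves [h_n]
    in the limit with no logarithm. At an integer pole the same constant meets an ordinary harmonic
    number instead, and this mismatch is the source of every [log 2] in the result. Working with
    finite [N] makes the decomposition into principal parts pure algebra, with no contour integral
    to estimate. The price is an exchange of limits on both sides, which needs bounds uniform in
    [N]; all of them reduce to the single majorant [H_n / n^2]. Half-integers are always taken in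
    pairs [+-(n + 1/2)], because a simple pole is only conditionally summable. In pairs it sums to
    [tau 1 = 0], so the residues never enter and the divergent [ttilde 1] cannot either. The pole at
    [0] has order [p + q + 1] and mixes three factors. Its polar part is first only shown to exist;
    its coefficients are then read off by comparing two polynomials up to an error [s^(p+q+1)] times
    a bounded function. *)

(** * Partial fractions of [x ^- q * y ^- m] *)

(** The induction step of [partial_fraction] with Pascal's rule abstracted into a recursion on
    coefficients, so that it serves both sums there, with [e] equal to [(x - y)^-1] and to its
    opposite. *)
Lemma sum_pascal (F : comPzRingType) (e : F) (a b Y : nat -> F) (m : nat) :
  b 0 = e * a 0 -> (forall i, b i.+1 = e * (a i.+1 - b i)) ->
  \sum_(i < m.+1) b i * Y (m.+1 - i)%N =
    e * (\sum_(i < m.+1) a i * Y (m.+1 - i)%N - \sum_(i < m) b i * Y (m - i)%N).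
Proof.
move=> b0 bS; rewrite !big_ord_recl /= b0 -addrA -sumrB mulrDr mulr_sumr mulrA.
by congr (_ + _); apply: eq_bigr => i _; rewrite /bump /= add1n bS subSS; ring.
Qed.

(** Induction on [q], then on [m], through [1/(xy) = (1/y - 1/x) / (x - y)], which lowers one of the
    two exponents at a time. *)
Lemma partial_fraction (F : fieldType) (x y : F) (q m : nat) :
  x != 0 -> y != 0 -> x - y != 0 -> (0 < q + m)%N ->
  x ^- q * y ^- m =
    \sum_(i < m) (-1) ^+ i * 'C((q + i).-1, i)%:R * (x - y) ^- (q + i) * y ^- (m - i)
    + \sum_(i < q) (-1) ^+ m * 'C((m + i).-1, i)%:R * (x - y) ^- (m + i)
        * x ^- (q - i).
Proof.
move=> x0 y0 d0; elim: q m => [|q IHq] m.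
  case: m => // m _; rewrite big_ord0 addr0 expr0 invr1 mul1r big_ord_recl big1.
    by rewrite addr0 bin0 !mul1r /= expr0 invr1 mul1r subn0.
  (* With exponent [0] the binomial is ['C(i.-1, i)], which is [0] for [i > 0]; only the index [0]
     survives. *)
  by move=> i _; rewrite bin_small // mulr0 !mul0r.
elim: m => [_|m IHm _].
  rewrite big_ord0 add0r expr0 invr1 mulr1 big_ord_recl big1.
    by rewrite addr0 bin0 !mul1r /= expr0 invr1 mul1r subn0.
  by move=> i _; rewrite bin_small // mulr0 !mul0r.
have -> : x ^- q.+1 * y ^- m.+1
  = (x - y)^-1 * (x ^- q * y ^- m.+1 - x ^- q.+1 * y ^- m).
  by rewrite !exprS; field; rewrite d0 x0 y0 ?expf_neq0.
rewrite IHq ?addnS // IHm //.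
have dK k : (x - y) ^- k.+1 = (x - y)^-1 * (x - y) ^- k by rewrite exprS invfM.
pose a r i : F := (-1) ^+ i * 'C((r + i).-1, i)%:R * (x - y) ^- (r + i).
pose b r i : F := (-1) ^+ r * 'C((r + i).-1, i)%:R * (x - y) ^- (r + i).
have aS : \sum_(i < m.+1) a q.+1 i * y ^- (m.+1 - i) = (x - y)^-1 *
  (\sum_(i < m.+1) a q i * y ^- (m.+1 - i) - \sum_(i < m) a q.+1 i * y ^- (m - i)).
  apply: (@sum_pascal _ _ (a q) (a q.+1) (fun k => y ^- k)) => [|i]; rewrite /a.
    by rewrite !addn0 /= !bin0 dK; ring.
  by rewrite !addSn !addnS /= dK binS natrD dK exprS; ring.
have bS : \sum_(i < q.+1) b m.+1 i * x ^- (q.+1 - i) = - (x - y)^-1 *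
  (\sum_(i < q.+1) b m i * x ^- (q.+1 - i) - \sum_(i < q) b m.+1 i * x ^- (q - i)).
  apply: (@sum_pascal _ _ (b m) (b m.+1) (fun k => x ^- k)) => [|i]; rewrite /b.
    by rewrite !addn0 /= !bin0 dK exprS; ring.
  by rewrite !addSn !addnS /= dK binS natrD dK !exprS; ring.
by rewrite aS bS; ring.
Qed.

Local Open Scope classical_set_scope.

(** * Limits of series and dominated convergence *)

Lemma cvg_sumr (R : realType) (I : Type) (r : seq I) (P : pred I)
    (u : nat -> I -> R) (l : I -> R) :
  (forall i, P i -> u n i @[n --> \oo] --> l i) ->
  \sum_(i <- r | P i) u n i @[n --> \oo] --> \sum_(i <- r | P i) l i.
Proof.
move=> ul; elim: r => [|i r IH].
  by rewrite big_nil; under eq_fun do rewrite big_nil; exact: cvg_cst.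
rewrite big_cons; under eq_fun do rewrite big_cons.
by case: ifP => // Pi; apply: cvgD => //; exact: ul.
Qed.

Lemma cvg_addn (R : realType) (k : nat) (u : nat -> R) (l : R) :
  u (n + k)%N @[n --> \oo] --> l -> u @ \oo --> l.
Proof. by rewrite (@cvg_shiftn k R u). Qed.

Lemma cvg_series_sum (R : realType) (I : Type) (r : seq I) (P : pred I)
    (u : nat -> I -> R) (l : I -> R) :
  (forall i, P i -> series (u^~ i) @ \oo --> l i) ->
  series (fun n => \sum_(i <- r | P i) u n i) @ \oo --> \sum_(i <- r | P i) l i.
Proof.
move=> ul; have -> : series (fun n => \sum_(i <- r | P i) u n i) =
    (fun n => \sum_(i <- r | P i) series (u^~ i) n).
  by apply: funext => n; rewrite /series /= exchange_big.
exact: cvg_sumr.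
Qed.

Lemma cvg_series_scale (R : realType) (c : R) (u : nat -> R) (l : R) :
  series u @ \oo --> l -> series (fun n => c * u n) @ \oo --> c * l.
Proof.
move=> ul; have -> : series (fun n => c * u n) = (fun n => c * series u n).
  by apply: funext => n; rewrite /series /= mulr_sumr.
by apply: cvgM => //; exact: cvg_cst.
Qed.

Lemma cvg_series_add (R : realType) (u v : nat -> R) (a b : R) :
  series u @ \oo --> a -> series v @ \oo --> b ->
  series (fun n => u n + v n) @ \oo --> a + b.
Proof.
move=> ua vb; have -> : series (fun n => u n + v n) = (fun n => series u n + series v n).
  by apply: funext => n; rewrite /series /= big_split.
exact: cvgD.
Qed.

Lemma series_bounded_cvg (R : realType) (u : nat -> R) (C : R) :
  (forall n, 0 <= u n) -> (forall n, series u n <= C) -> cvgn (series u).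
Proof.
move=> u0 uC; apply: nondecreasing_is_cvgn; first exact: nondecreasing_series.
by exists C => _ [n _ <-].
Qed.

Lemma series_dominated_cvg (R : realType) (u g : nat -> R) :
  (forall n, `|u n| <= g n) -> cvgn (series g) -> cvgn (series u).
Proof.
move=> ug cg; apply: normed_cvg; apply: (@series_le_cvg _ _ g) => // n /=.
  exact: normr_ge0.
exact: le_trans (normr_ge0 (u n)) (ug n).
Qed.

Lemma series_tail_le (R : realType) (u g : nat -> R) (l : R) (M : nat) :
  (forall n, `|u n| <= g n) -> cvgn (series g) -> series u @ \oo --> l ->
  `|l - series u M| <= limn (series g) - series g M.
Proof.
move=> ug cg ul.
have h1 : `|series u n - series u M| @[n --> \oo] --> `|l - series u M|.
  by apply: cvg_norm; apply: cvgB => //; exact: cvg_cst.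
have h2 : series g n - series g M @[n --> \oo] --> limn (series g) - series g M.
  by apply: cvgB => //; exact: cvg_cst.
apply: (ler_cvg_to h1 h2); near=> n.
have Mn : (M <= n)%N by near: n; exact: nbhs_infty_ge.
rewrite !sub_series_geq //; apply: le_trans (ler_norm_sum _ _ _) _.
by apply: ler_sum => i _.
Unshelve. all: by end_near. Qed.

(** The inner series enter only through their values [F N], so that the closed form of a sum over
    half-integers can be plugged in directly. *)
Lemma tannery (R : realType) (f : nat -> nat -> R) (phi g F : nat -> R) :
  (forall n, f N n @[N --> \oo] --> phi n) ->
  (forall N n, `|f N n| <= g n) -> cvgn (series g) ->
  (forall N, series (f N) @ \oo --> F N) ->
  F @ \oo --> limn (series phi).
Proof.
move=> fphi fg cg fF.
have phig n : `|phi n| <= g n.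
  apply: (ler_cvg_to (cvg_norm (fphi n)) (cvg_cst (g n))).
  by near=> N; exact: fg.
have cphi := series_dominated_cvg phig cg.
apply/cvgrPdist_le => e e0.
(* Three errors are paid for: the tail of [phi], the tail of [f N], both bounded by the tail of [g]
   beyond [M], and the difference of the first [M] terms. *)
have e40 : 0 < e / 4 by rewrite divr_gt0.
have /cvgrPdist_le/(_ _ e40)[M _ /(_ M (leqnn _)) gM] := cg.
have sf : series (f N) M @[N --> \oo] --> series phi M.
  by rewrite /series /=; apply: cvg_sumr.
have /cvgrPdist_le/(_ _ e40) := sf; apply: filterS => N /= fN.
have t1 := series_tail_le M (fg N) cg (fF N).
have t2 := series_tail_le M phig cg cphi.
have g4 : limn (series g) - series g M <= e / 4 by apply: le_trans gM; exact: ler_norm.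
move: fN t1 t2; rewrite !ler_norml.
by move=> /andP[? ?] /andP[? ?] /andP[? ?]; apply/andP; split; lra.
Unshelve. all: by end_near. Qed.

(** * Harmonic numbers over integers and half-integers *)

Section Numbers.
Variable R : realType.

Definition half_int n : R := n.+1%:R - 2^-1.

Lemma half_int_ge n : n.+1%:R / 2 <= half_int n.
Proof. by rewrite /half_int -natr1; have := ler0n R n; lra. Qed.

Lemma half_int_gt0 n : 0 < half_int n.
Proof. by apply: lt_le_trans (half_int_ge n); rewrite divr_gt0. Qed.

Lemma hnumE p n : hnum R p n = \sum_(k < n) half_int k ^- p.
Proof. by rewrite /hnum big_add1 /= big_mkord. Qed.

Lemma HnumE p n : Hnum R p n = \sum_(k < n) k.+1%:R ^- p.
Proof. by rewrite /Hnum big_add1 /= big_mkord. Qed.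

Lemma hnumS p n : hnum R p n.+1 = hnum R p n + half_int n ^- p.
Proof. by rewrite !hnumE big_ord_recr. Qed.

Lemma HnumS p n : Hnum R p n.+1 = Hnum R p n + n.+1%:R ^- p.
Proof. by rewrite !HnumE big_ord_recr. Qed.

Lemma hnum0 p : hnum R p 0 = 0. Proof. by rewrite hnumE big_ord0. Qed.
Lemma Hnum0 p : Hnum R p 0 = 0. Proof. by rewrite HnumE big_ord0. Qed.

(** The common majorant of all the Tannery arguments: the square uses [q >= 2], and the harmonic
    number absorbs the logarithmic growth of [B_N] and of its Taylor coefficients. *)
Definition harmonic_dom n : R := Hnum R 1 n.+1 / n.+1%:R ^+ 2.

Lemma Hnum_ge0 p n : 0 <= Hnum R p n.
Proof. by rewrite HnumE sumr_ge0 // => i _; rewrite invr_ge0 exprn_ge0. Qed.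

Lemma hnum_ge0 p n : 0 <= hnum R p n.
Proof.
by rewrite hnumE sumr_ge0 // => i _; rewrite invr_ge0 exprn_ge0 // ltW ?half_int_gt0.
Qed.

Lemma Hnum1_ge1 n : 1 <= Hnum R 1 n.+1.
Proof.
elim: n => [|n IH]; first by rewrite HnumS Hnum0 add0r expr1 invr1.
by rewrite HnumS; apply: le_trans IH _; rewrite lerDl invr_ge0 exprn_ge0.
Qed.

Lemma cvg_harmonic_dom : cvgn (series harmonic_dom).
Proof.
(* The bound [4] is the value of [2 (H_n + 1) / n] at [n = 1]. *)
apply: (@series_bounded_cvg _ _ 4) => n.
  by rewrite divr_ge0 ?Hnum_ge0 ?exprn_ge0.
(* The terms are dominated by the differences of [2 (H_n + 1) / n]. *)
suff : series harmonic_dom n + 2 * (Hnum R 1 n.+1 + 1) / n.+1%:R <= 4.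
  apply: le_trans; rewrite lerDl divr_ge0 // mulr_ge0 // addr_ge0 ?Hnum_ge0 //.
elim: n => [|n]; first by rewrite /series /= big_geq // HnumS Hnum0 expr1 invr1; lra.
apply: le_trans; rewrite seriesSr -addrA lerD2l [Hnum R 1 n.+2]HnumS.
rewrite /harmonic_dom; have := Hnum_ge0 1 n.+1; move: (Hnum R 1 n.+1) => H H0.
rewrite -(natr1 n.+1) expr1; have : 1 <= n.+1%:R :> R by rewrite ler1n.
move: n.+1%:R => x x1; have x0 : 0 < x by lra.
have x10 : 0 < x + 1 by lra.
rewrite -subr_ge0.
have -> : 2 * (H + 1) / x - (H / x ^+ 2 + 2 * (H + (x + 1)^-1 + 1) / (x + 1)) =
  (H * (x - 1) * (x + 1) + 2 * x) / (x ^+ 2 * (x + 1) ^+ 2).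
  by field; rewrite !gt_eqF.
apply: divr_ge0; last by rewrite mulr_ge0 // exprn_ge0 // ltW.
by rewrite addr_ge0 // ?mulr_ge0 //; lra.
Qed.

Lemma cvg_harmonic_domZ C : cvgn (series (fun n => C * harmonic_dom n)).
Proof. by apply/cvg_ex; eexists; apply: cvg_series_scale; exact: cvg_harmonic_dom. Qed.

Lemma invX_harmonic_dom n q : (1 < q)%N -> n.+1%:R ^- q <= harmonic_dom n.
Proof.
move=> q1; rewrite /harmonic_dom; apply: (@le_trans _ _ (n.+1%:R ^- 2)).
  by rewrite lef_pV2 ?posrE ?exprn_gt0 // ler_weXn2l // ler1n.
by rewrite ler_peMl ?Hnum1_ge1 // invr_ge0 exprn_ge0.
Qed.

Lemma half_int_inv_le n q : half_int n ^- q <= 2 ^+ q * n.+1%:R ^- q.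
Proof.
rewrite -!exprVn -exprMn.
have h0 := half_int_gt0 n.
apply: lerXn2r; rewrite ?nnegrE ?invr_ge0 ?(ltW h0) ?divr_ge0 //.
rewrite -[leRHS]invrK lef_pV2 ?posrE ?half_int_gt0 ?invr_gt0 ?divr_gt0 // invf_div.
exact: half_int_ge.
Qed.

Lemma half_int_harmonic_dom n q : (1 < q)%N -> half_int n ^- q <= 2 ^+ q * harmonic_dom n.
Proof.
move=> q1; apply: le_trans (half_int_inv_le n q) _.
by rewrite ler_wpM2l ?exprn_ge0 // invX_harmonic_dom.
Qed.

Lemma cvg_Hnum q : (1 < q)%N -> Hnum R q @ \oo --> zeta R q.
Proof.
move=> q1; have -> : Hnum R q = series (fun n => n.+1%:R ^- q).
  by apply: funext => n; rewrite HnumE /series /= big_mkord.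
apply: (series_dominated_cvg _ cvg_harmonic_dom) => n.
by rewrite ger0_norm ?invr_ge0 ?exprn_ge0 // invX_harmonic_dom.
Qed.

Lemma cvg_hnum q : (1 < q)%N -> hnum R q @ \oo --> ttilde R q.
Proof.
move=> q1; have -> : hnum R q = series (fun n => half_int n ^- q).
  by apply: funext => n; rewrite hnumE /series /= big_mkord.
suff : cvgn (series (fun n => half_int n ^- q)) by [].
apply: (series_dominated_cvg _ (@cvg_harmonic_domZ (2 ^+ q))) => n.
by rewrite ger0_norm ?half_int_harmonic_dom // invr_ge0 exprn_ge0 // ltW ?half_int_gt0.
Qed.

Lemma hnum_mono p : {homo hnum R p : m n / (m <= n)%N >-> m <= n}.
Proof.
apply: homo_leq; [exact: lexx|by move=> y x z; exact: le_trans|move=> n].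
by rewrite hnumS lerDl invr_ge0 exprn_ge0 // ltW ?half_int_gt0.
Qed.

Lemma Hnum_mono p : {homo Hnum R p : m n / (m <= n)%N >-> m <= n}.
Proof.
apply: homo_leq; [exact: lexx|by move=> y x z; exact: le_trans|move=> n].
by rewrite HnumS lerDl invr_ge0 exprn_ge0.
Qed.

Lemma Hnum_le_zeta p n : (1 < p)%N -> Hnum R p n <= zeta R p.
Proof.
move=> p1; apply: (ler_cvg_to (cvg_cst (Hnum R p n)) (cvg_Hnum p1)).
by exists n => // m /= nm; exact: Hnum_mono.
Qed.

Lemma hnum_le_ttilde p n : (1 < p)%N -> hnum R p n <= ttilde R p.
Proof.
move=> p1; apply: (ler_cvg_to (cvg_cst (hnum R p n)) (cvg_hnum p1)).
by exists n => // m /= nm; exact: hnum_mono.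
Qed.

Lemma hnum1_le n : hnum R 1 n <= 2 * Hnum R 1 n.
Proof.
elim: n => [|n IH]; first by rewrite hnum0 Hnum0 mulr0.
rewrite hnumS HnumS mulrDr lerD //.
by have := half_int_inv_le n 1; rewrite expr1.
Qed.

(** The summands decrease, so a block of [n] later terms is at most the sum of the first [n]. This
    keeps differences of divergent sums bounded uniformly in [N]. *)
Lemma hnum1_sub m n : hnum R 1 (m + n) <= hnum R 1 m + hnum R 1 n.
Proof.
elim: n => [|n IH]; first by rewrite addn0 hnum0 addr0.
rewrite addnS !hnumS addrA lerD // !expr1 lef_pV2 ?posrE ?half_int_gt0 //.
by rewrite /half_int lerD2r ler_nat ltnS leq_addl.
Qed.

Lemma Hnum1_sub m n : Hnum R 1 (m + n) <= Hnum R 1 m + Hnum R 1 n.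
Proof.
elim: n => [|n IH]; first by rewrite addn0 Hnum0 addr0.
rewrite addnS !HnumS addrA lerD // !expr1 lef_pV2 ?posrE //.
by rewrite ler_nat ltnS leq_addl.
Qed.

Lemma Hnum_leHnum1 p n : (0 < p)%N -> Hnum R p n <= Hnum R 1 n.
Proof.
move=> p0; rewrite !HnumE; apply: ler_sum => i _.
by rewrite lef_pV2 ?posrE ?exprn_gt0 // ler_weXn2l // ler1n.
Qed.

(** Since [1/(k - 1/2) = 2/(2k - 1)], the sum runs over the odd denominators below [2n]: all
    denominators minus the even ones. *)
Lemma hnum_Hnum_double n : hnum R 1 n = 2 * Hnum R 1 n.*2 - Hnum R 1 n.
Proof.
elim: n => [|n IH]; first by rewrite hnum0 !Hnum0; lra.
rewrite doubleS !HnumS hnumS IH /half_int.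
have n0 := ler0n R n.
rewrite !expr1 -muln2 -[n.+1%:R]natr1 -[(n * 2).+2%:R]natr1 -[(n * 2).+1%:R]natr1 natrM.
by field; rewrite !gt_eqF //; lra.
Qed.

(** Both sides are [ln (1 + x) <= x], at [x = -1/(n+2)] and at [x = 1/(n+1)]. *)
Lemma inv_ln_le (n : nat) :
  n.+2%:R^-1 <= ln (n.+2%:R : R) - ln n.+1%:R <= n.+1%:R^-1.
Proof.
have n1 : 0 < n.+1%:R :> R by [].
have n2 : 0 < n.+2%:R :> R by [].
have n0 := ler0n R n.
rewrite -ln_div ?posrE //; apply/andP; split.
  have -> : n.+2%:R / n.+1%:R = (1 - n.+2%:R^-1)^-1 :> R.
    rewrite -[n.+2%:R]natr1; field.
    by apply/andP; split; rewrite gt_eqF //; lra.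
  rewrite lnV ?posrE; last by rewrite subr_gt0 invf_lt1 // ltr1n.
  by rewrite lerNr; apply: le_ln1Dx; rewrite ltrN2 invf_lt1 // ltr1n.
have -> : n.+2%:R / n.+1%:R = 1 + n.+1%:R^-1 :> R.
  by rewrite -[n.+2%:R]natr1; field; rewrite gt_eqF //; lra.
by apply: le_ln1Dx; apply: (@lt_trans _ _ 0); rewrite ?invr_gt0 //; lra.
Qed.

Lemma Hnum_sub_ln m n :
  ln (m + n).+1%:R - ln m.+1%:R <= Hnum R 1 (m + n) - Hnum R 1 m.
Proof.
elim: n => [|n IH]; first by rewrite addn0 !subrr.
rewrite addnS HnumS; have /andP[_] := inv_ln_le (m + n); rewrite expr1.
by move: IH (_^-1) => IH i; lra.
Qed.

Lemma Hnum_sub_ln_le m n : (0 < m)%N ->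
  Hnum R 1 (m + n) - Hnum R 1 m <= ln (m + n)%:R - ln m%:R.
Proof.
case: m => // m _; elim: n => [|n IH]; first by rewrite addn0 !subrr.
rewrite !addnS HnumS; have /andP[+ _] := inv_ln_le (m + n); rewrite expr1.
by move: IH (_^-1) => + i; rewrite !addSn; lra.
Qed.

Lemma cvg_invn : (n.+1%:R^-1 : R) @[n --> \oo] --> (0 : R).
Proof. exact: cvg_harmonic. Qed.

(** By the doubling formula the difference is [2 (H_{2n} - H_n)], and the comparison with logarithms
    squeezes [H_{2n} - H_n] towards [ln 2] with an error of order [1/n]. *)
Lemma cvg_hnum_sub_Hnum : hnum R 1 n - Hnum R 1 n @[n --> \oo] --> 2 * ln (2 : R).
Proof.
have bnd n : 2 * ln 2 - 2 * n.+1%:R^-1 <= hnum R 1 n.+1 - Hnum R 1 n.+1 <= 2 * ln (2 : R).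
  rewrite hnum_Hnum_double -addnn.
  have n1 : 0 < n.+1%:R :> R by [].
  have := @Hnum_sub_ln_le n.+1 n.+1 isT.
  have := @Hnum_sub_ln n.+1 n.+1.
  have -> : ln (n.+1 + n.+1)%:R - ln n.+1%:R = ln 2 :> R.
    by rewrite -ln_div ?posrE //; congr ln; rewrite natrD; field; rewrite nat1r gt_eqF.
  have h1 : ln 2 - n.+1%:R^-1 <= ln (n.+1 + n.+1).+1%:R - ln (n.+2%:R : R).
    have /andP[_] := inv_ln_le n.
    have l1 : ln (n.+1 + n.+1)%:R <= ln (n.+1 + n.+1).+1%:R :> R.
      by rewrite ler_ln ?posrE // ler_nat.
    have e2 : (n.+1 + n.+1)%:R = 2 * n.+1%:R :> R by rewrite natrD; ring.
    move: l1; rewrite e2 lnM ?posrE //.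
    by move: (_^-1) => i; lra.
  by move: (_^-1) h1 => i; lra.
apply: (@cvg_addn _ 1 (fun n => hnum R 1 n - Hnum R 1 n)); under eq_fun do rewrite addn1.
apply: (@squeeze_cvgr _ _ _ _ (fun n => 2 * ln 2 - 2 * n.+1%:R^-1) (fun=> 2 * ln 2)).
- by near=> n; exact: bnd.
- rewrite -[X in _ --> X]subr0 -[X in _ --> _ - X](mulr0 2).
  by apply: cvgB; [exact: cvg_cst|apply: cvgM; [exact: cvg_cst|exact: cvg_invn]].
- exact: cvg_cst.
Unshelve. all: by end_near. Qed.

End Numbers.

(** * Sums of poles over the half-integers *)

Section Poles.
Variable R : realType.
Local Notation half_int := (@half_int R).

(* The value at [0] makes [tau (K - i)] vanish for [K <= i]; [tau 1] is [0] whatever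
   the junk value [ttilde R 1] is. *)
Definition tau (m : nat) : R :=
  if m is 0 then 0 else (1 + (-1) ^+ m) * ttilde R m.

Lemma tau1 : tau 1 = 0.
Proof. by rewrite /tau expr1 subrr mul0r. Qed.

Lemma cvg_half_int_invX m : (0 < m)%N -> half_int n ^- m @[n --> \oo] --> (0 : R).
Proof.
move=> m0.
apply: (@squeeze_cvgr _ _ _ _ (fun=> 0 : R) (fun n => 2 ^+ m * n.+1%:R^-1 : R)).
- near=> n; rewrite invr_ge0 exprn_ge0 /=; last by apply: ltW; exact: half_int_gt0.
  apply: le_trans (half_int_inv_le R n m) _; rewrite ler_wpM2l ?exprn_ge0 //.
  by rewrite lef_pV2 ?posrE ?exprn_gt0 // -[leLHS]expr1 ler_weXn2l // ler1n.
- exact: cvg_cst.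
- rewrite -[X in _ --> X](mulr0 (2 ^+ m)).
  by apply: cvgM; [exact: cvg_cst|exact: cvg_invn].
Unshelve. all: by end_near. Qed.

Lemma half_int_addn n c : half_int (n + c) = half_int n + c%:R.
Proof. by rewrite /half_int -addSn natrD; ring. Qed.

Lemma invXN (x : R) m : (- x) ^- m = (-1) ^+ m * x ^- m.
Proof. by rewrite -[in LHS]mulN1r exprMn invfM -[X in X * _ = _]exprVn invrN1. Qed.

(* Summed over all half-integers, a pole does not depend on its position: moving
   it from [c] to [c + 1] telescopes. *)
Lemma cvg_series_pole c m : (0 < m)%N ->
  series (fun n => (half_int n - c%:R) ^- m + (- half_int n - c%:R) ^- m) @ \oo --> tau m.
Proof.
move=> m0; elim: c => [|c IH].
  have -> : (fun n => (half_int n - 0%:R) ^- m + (- half_int n - 0%:R) ^- m) =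
      (fun n => (1 + (-1) ^+ m) * half_int n ^- m).
    by apply: funext => n; rewrite !subr0 invXN; ring.
  case: m m0 => // -[_|m _].
    rewrite tau1; have -> : series (fun n => (1 + (-1) ^+ 1) * half_int n ^- 1) =
      (fun=> 0).
      by apply: funext => n; rewrite /series /= big1 // => i _; rewrite expr1 subrr mul0r.
    exact: cvg_cst.
  apply: cvg_series_scale.
  have -> : series (fun n => half_int n ^- m.+2) = hnum R m.+2.
    by apply: funext => n; rewrite hnumE /series /= big_mkord.
  exact: cvg_hnum.
(* The first [M] pairs, shifted by [c], are [2M] consecutive half-integers. Shifting once more adds
   [- half_int (M + c)] at the lower end and drops [half_int M - c.+1%:R] at the upper end; both
   contributions tend to [0]. *)
have -> : series (fun n => (half_int n - c.+1%:R) ^- m + (- half_int n - c.+1%:R) ^- m) =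
    (fun M => series (fun n => (half_int n - c%:R) ^- m + (- half_int n - c%:R) ^- m) M
      + ((-1) ^+ m * half_int (M + c) ^- m - (half_int M - c.+1%:R) ^- m)).
  apply: funext; elim=> [|M IHM].
    rewrite /series /= !big_geq // add0r -invXN add0n.
    have -> : - half_int c = half_int 0 - c.+1%:R by rewrite /half_int; lra.
    by rewrite subrr.
  have e1 : half_int M.+1 - c.+1%:R =
      half_int M - c%:R by rewrite /half_int -!natr1; ring.
  have e2 : - half_int M - c.+1%:R = - half_int (M.+1 + c).
    by rewrite /half_int -addSn natrD -!natr1; ring.
  have e3 : - half_int M - c%:R =
      - half_int (M + c) by rewrite /half_int -addSn natrD; ring.
  by rewrite !seriesSr IHM -!invXN e1 e2 e3; ring.
rewrite -[X in _ --> X]addr0; apply: cvgD => //.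
have -> : (0 : R) = (-1) ^+ m * 0 - 0 by rewrite mulr0 subr0.
apply: cvgB; last first.
  apply: (@cvg_addn _ c.+1 (fun M => (half_int M - c.+1%:R) ^- m)).
  by under eq_fun do rewrite half_int_addn addrK; exact: cvg_half_int_invX.
apply: cvgM; first exact: cvg_cst.
have := cvg_half_int_invX m0; rewrite -(@cvg_shiftn c R (fun n => half_int n ^- m)).
exact.
Qed.

(** One condition covering both places where the kernel is evaluated: the half-integers of either
    sign, and the interval [(0, 1/2)] on which the pole at [0] is examined. *)
Definition nonnat (s : R) := forall k, s != k%:R.

Lemma nonnat_half_int n : nonnat (half_int n).
Proof.
move=> k; apply/eqP; rewrite /half_int => e.
have : (n.+1 * 2 = k * 2 + 1)%N.
  by apply/eqP; rewrite -(eqr_nat R) natrD !natrM; apply/eqP; lra.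
lia.
Qed.

Lemma nonnat_half_intN n : nonnat (- half_int n).
Proof.
move=> k; rewrite lt_eqF // (@lt_le_trans _ _ 0) // oppr_lt0.
exact: half_int_gt0.
Qed.

Lemma expr_divn_sub (s : R) i K : s != 0 -> (i <= K)%N ->
  s ^+ i / s ^+ K = s ^- (K - i).
Proof.
move=> s0 iK; rewrite -{1}(subnK iK) exprD invfM mulrCA mulfV ?mulr1 //.
by rewrite expf_neq0.
Qed.

(** A combination of [s^-1, ..., s^-K]. Leaving the coefficients existential avoids tracking how the
    many poles contribute to the polar part at [0]. *)
Definition polar K (f : R -> R) :=
  exists2 a : {poly R}, (size a <= K)%N & forall s, s != 0 -> f s = a.[s] / s ^+ K.

Lemma polarZ K c f : polar K f -> polar K (fun s => c * f s).
Proof.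
move=> [a sa fa]; exists (c *: a); first exact: leq_trans (size_scale_leq _ _) sa.
by move=> s s0; rewrite fa // hornerZ mulrA.
Qed.

Lemma polarD K f g : polar K f -> polar K g -> polar K (fun s => f s + g s).
Proof.
move=> [a sa fa] [b sb gb]; exists (a + b).
  by rewrite (leq_trans (size_polyD _ _)) // geq_max sa.
by move=> s s0; rewrite fa // gb // hornerD mulrDl.
Qed.

Lemma polar_sum K (I : Type) (r : seq I) (P : pred I) (f : I -> R -> R) :
  (forall i, P i -> polar K (f i)) -> polar K (fun s => \sum_(i <- r | P i) f i s).
Proof.
move=> fP; elim: r => [|i r IH].
  exists 0; first by rewrite size_poly0.
  by move=> s _; rewrite big_nil horner0 mul0r.
case Pi : (P i); last by under eq_fun do rewrite big_cons Pi.
by under eq_fun do rewrite big_cons Pi; apply: polarD => //; exact: fP.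
Qed.

Lemma polar_inv K r : (0 < r <= K)%N -> polar K (fun s => s ^- r).
Proof.
move=> /andP[r0 rK]; exists 'X^(K - r); first by rewrite size_polyXn; lia.
by move=> s s0; rewrite hornerXn expr_divn_sub ?leq_subr // subKn.
Qed.

(* The sum over the half-integers of the polar part of [P(s) / s^K]. *)
Definition Lam K (P : {poly R}) : R := \sum_(i < K) P`_i * tau (K - i).

Lemma Lam_X K i : Lam K 'X^i = tau (K - i).
Proof.
rewrite /Lam; have [iK|Ki] := ltnP i K.
  rewrite (bigD1 (Ordinal iK)) //= coefXn eqxx mul1r big1 ?addr0 // => j jn.
  by rewrite coefXn (_ : (_ == _) = false) ?mul0r //; apply: contraNF jn.
rewrite (eqP Ki) big1 // => j _; rewrite coefXn ltn_eqF ?mul0r //.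
exact: leq_trans Ki.
Qed.

Lemma LamD K P Q : Lam K (P + Q) = Lam K P + Lam K Q.
Proof. by rewrite -big_split; apply: eq_bigr => i _; rewrite coefD mulrDl. Qed.

Lemma LamZ K c P : Lam K (c *: P) = c * Lam K P.
Proof. by rewrite mulr_sumr; apply: eq_bigr => i _; rewrite coefZ mulrA. Qed.

Lemma Lam_sum K (I : Type) (r : seq I) (P : pred I) (f : I -> {poly R}) :
  Lam K (\sum_(i <- r | P i) f i) = \sum_(i <- r | P i) Lam K (f i).
Proof.
elim/big_rec2: _ => [|i y1 y2 _ <-]; last by rewrite LamD.
by rewrite /Lam big1 // => i _; rewrite coef0 mul0r.
Qed.

Lemma cvg_series_polar K (a : {poly R}) : (size a <= K)%N ->
  series (fun n => a.[half_int n] / half_int n ^+ K +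
      a.[- half_int n] / (- half_int n) ^+ K) @ \oo
    --> Lam K a.
Proof.
move=> sa.
have e s : s != 0 -> a.[s] / s ^+ K = \sum_(i < K) a`_i * (s - 0%:R) ^- (K - i).
  move=> s0; rewrite (horner_coef_wide _ sa) mulr_suml subr0; apply: eq_bigr => i _.
  rewrite -mulrA; congr (_ * _).
  by rewrite expr_divn_sub // ltnW.
have h0 n : half_int n != 0 by rewrite gt_eqF ?half_int_gt0.
have -> : (fun n => a.[half_int n] / half_int n ^+ K +
    a.[- half_int n] / (- half_int n) ^+ K) =
  (fun n => \sum_(i < K) a`_i * ((half_int n - 0%:R) ^- (K - i) +
      (- half_int n - 0%:R) ^- (K - i))).
  apply: funext => n; rewrite !e ?oppr_eq0 // -big_split.
  by apply: eq_bigr => i _; rewrite mulrDr.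
apply: cvg_series_sum => i _; apply: cvg_series_scale.
by apply: cvg_series_pole; rewrite subn_gt0.
Qed.

(** * Identification of coefficients at [0] by boundedness *)

(** Plays the part of [O(1)] at [0]. On [(0, 1/2)] every pole at a positive integer is at distance
    at least [1/2]. *)
Definition bd (f : R -> R) := exists C, forall s, 0 < s < 2^-1 -> `|f s| <= C.

Lemma bdD f g : bd f -> bd g -> bd (fun s => f s + g s).
Proof.
move=> [C fC] [D gD]; exists (C + D) => s h.
by rewrite (le_trans (ler_normD _ _)) // lerD ?fC ?gD.
Qed.

Lemma bdM f g : bd f -> bd g -> bd (fun s => f s * g s).
Proof.
move=> [C fC] [D gD]; exists (C * D) => s h.
by rewrite normrM ler_pM ?fC ?gD.
Qed.

Lemma bd_cst c : bd (fun=> c). Proof. by exists `|c|. Qed.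

Lemma bd_sum (I : Type) (r : seq I) (P : pred I) (f : I -> R -> R) :
  (forall i, P i -> bd (f i)) -> bd (fun s => \sum_(i <- r | P i) f i s).
Proof.
move=> fP; elim: r => [|i r IH].
  by under eq_fun do rewrite big_nil; exact: bd_cst.
case Pi : (P i); last by under eq_fun do rewrite big_cons Pi.
by under eq_fun do rewrite big_cons Pi; apply: bdD => //; exact: fP.
Qed.

Lemma bd_exp i : bd (fun s => s ^+ i).
Proof.
exists 1 => s /andP[s0 s1]; have s0' := ltW s0.
by rewrite ger0_norm ?exprn_ge0 // exprn_ile1 //; lra.
Qed.

Lemma bd_horner (P : {poly R}) : bd (fun s => P.[s]).
Proof.
under eq_fun do rewrite horner_coef.
by apply: bd_sum => i _; apply: bdM; [exact: bd_cst|exact: bd_exp].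
Qed.

Lemma bd_pole k m : bd (fun s => (s - k.+1%:R) ^- m).
Proof.
exists (2 ^+ m) => s /andP[s0 s1].
have k1 : 1 <= k.+1%:R :> R by rewrite ler1n.
have sk : s - k.+1%:R < 0 by lra.
rewrite normrV ?unitfE ?expf_neq0 ?(lt_eqF sk) // normrX -exprVn.
rewrite lerXn2r ?nnegrE ?invr_ge0 // -[leRHS]invrK.
by rewrite lef_pV2 ?posrE ?invr_gt0 ?normr_gt0 ?(lt_eqF sk) // ltr0_norm //; lra.
Qed.

(** Uniqueness of a Taylor polynomial: a polynomial that is [O(s^K)] has no coefficient below [K].
    The constant coefficient is [O(s)], hence [0]; dividing by [s] lowers [K]. *)
Lemma bd_coef0 K (P : {poly R}) :
  (exists2 r, bd r & forall s, 0 < s < 2^-1 -> P.[s] = s ^+ K * r s) ->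
  forall i, (i < K)%N -> P`_i = 0.
Proof.
elim: K P => // K IH P [r br Pr].
have PE : P = drop_poly 1 P * 'X + (P`_0)%:P.
  by rewrite -{1}(poly_take_drop 1 P) expr1 addrC; congr (_ + _);
     apply/polyP => -[|i]; rewrite coef_take_poly coefC.
set Q := drop_poly 1 P in PE *.
have c0 : P`_0 = 0.
  have [C rC] := br; have [D QD] := bd_horner Q.
  have C0 : 0 <= C by apply: le_trans (normr_ge0 _) (rC 4^-1 _); lra.
  have D0 : 0 <= D by apply: le_trans (normr_ge0 _) (QD 4^-1 _); lra.
  have bnd s : 0 < s < 2^-1 -> `|P`_0| <= s * (C + D).
    move=> hs; have /andP[s0 s1] := hs.
    have -> : P`_0 = P.[s] - Q.[s] * s.
      by rewrite {2}PE hornerD hornerM hornerX hornerC; ring.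
    rewrite (le_trans (ler_normB _ _)) // mulrDr lerD //.
      rewrite Pr // normrM exprS normrM (gtr0_norm s0) -mulrA ler_wpM2l ?(ltW s0) //.
      rewrite -[leRHS]mul1r ler_pM // ?rC //.
      by rewrite ger0_norm ?exprn_ge0 ?exprn_ile1 ?(ltW s0) //; lra.
    by rewrite normrM (gtr0_norm s0) mulrC ler_wpM2l ?QD ?(ltW s0).
  apply/eqP; rewrite -normr_eq0 eq_le normr_ge0 andbT leNgt; apply/negP => a0.
  set a := `|P`_0| in a0 bnd.
  have E0 : 0 < C + D + a + 1 by lra.
  (* Small enough that [s (C + D) < a], against [a <= s (C + D)], while the summand [a] in the
     denominator keeps [s] below [1/2]. *)
  pose s := a / (C + D + a + 1) / 4.
  have s0 : 0 < s by rewrite !divr_gt0.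
  have sE : s * 4 * (C + D + a + 1) = a.
    by rewrite /s; field; rewrite gt_eqF.
  have s1 : s < 2^-1.
    by rewrite /s ltr_pdivrMr // ltr_pdivrMr //; lra.
  have := bnd s; rewrite s0 s1 => /(_ isT); nra.
case=> [_|i iK]; first exact: c0.
rewrite PE c0 polyC0 addr0 coefMX /=; apply: IH => //.
exists r => // s hs; have /andP[s0 _] := hs.
have sn0 : s != 0 by rewrite gt_eqF.
apply: (mulIf sn0).
by have := Pr s hs; rewrite PE c0 polyC0 addr0 hornerM hornerX exprS => ->; ring.
Qed.

End Poles.

(** * The truncated kernel and its principal parts *)

Section Kernel.
Variable R : realType.
Local Notation half_int := (@half_int R).

Definition Btrunc N (s : R) := hnum R 1 N.+1 + \sum_(k < N.+1) (s - k%:R)^-1.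

Definition Dtrunc p N (s : R) := \sum_(k < N.+1) (s - k%:R) ^- p.

(** The coefficient of [(s - n)^i] in the Taylor expansion at [n] of [B_N] deprived of its own pole
    there. *)
Definition Bcoef N i n : R := (if i is 0 then hnum R 1 N.+1 else 0)
  + \sum_(k < N.+1 | (k : nat) != n) (-1) ^+ i * (n%:R - k%:R) ^- i.+1.

(** The value at [n] of [D_N] deprived of its pole there, the sign turning [n - k] into [k - n]. *)
Definition Dcoef p N n : R :=
  \sum_(k < N.+1 | (k : nat) != n) (-1) ^+ p * (k%:R - n%:R) ^- p.

Lemma nonnat_sub (s : R) k : nonnat s -> s - k%:R != 0.
Proof. by move=> ns; rewrite subr_eq0. Qed.

(** Diagonal products give the pole of order [p + 1]. Each off-diagonal product
    [(s - k)^-1 (s - n)^-p] splits into a part [X] with pole at [n] and a simple pole [Y] at [k]. *)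
Lemma Btrunc_Dtrunc p N s : (0 < p)%N -> nonnat s ->
  Btrunc N s * Dtrunc p N s = \sum_(n < N.+1) ((s - n%:R) ^- p.+1
    + \sum_(i < p) Bcoef N i n * (s - n%:R) ^- (p - i) + Dcoef p N n * (s - n%:R)^-1).
Proof.
move=> p0 ns; have s0 k := @nonnat_sub s k ns.
pose X (n k : nat) := \sum_(i < p) (-1) ^+ i * (n%:R - k%:R) ^- i.+1 *
    (s - n%:R) ^- (p - i).
pose Y (n k : nat) := (-1) ^+ p * (n%:R - k%:R) ^- p * (s - k%:R)^-1.
have XY (n k : nat) : k != n -> (s - k%:R)^-1 * (s - n%:R) ^- p = X n k + Y n k.
  move=> kn; have d0 : (s - k%:R) - (s - n%:R) != 0.
    by rewrite opprB addrC addrA subrK subr_eq0 eqr_nat eq_sym.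
  have := @partial_fraction _ (s - k%:R) (s - n%:R) 1 p (s0 k) (s0 n) d0 isT.
  rewrite expr1 (_ : (s - k%:R) - (s - n%:R) = n%:R - k%:R); last by ring.
  move=> ->; rewrite big_ord1 addn0 bin0 mulr1 subn0 expr1; congr (_ + _).
  by apply: eq_bigr => i _; rewrite add1n /= binn mulr1.
have -> : Btrunc N s * Dtrunc p N s = \sum_(n < N.+1) (hnum R 1 N.+1 * (s - n%:R) ^- p
    + (s - n%:R) ^- p.+1 + \sum_(k < N.+1 | (k : nat) != n) (X n k + Y n k)).
  rewrite mulr_sumr; apply: eq_bigr => n _.
  rewrite mulrDl -addrA; congr (_ + _).
  rewrite mulr_suml (bigD1 n) //= exprS invfM; congr (_ + _).
  by apply: eq_bigr => k kn; apply: XY.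
under eq_bigr do rewrite big_split addrA; rewrite !big_split /=; congr (_ + _).
  rewrite -!big_split /=; apply: eq_bigr => n _.
  rewrite [_ * _ + _]addrC -addrA; congr (_ + _).
  under [RHS]eq_bigr do rewrite mulrDl mulr_suml; rewrite big_split /=.
  rewrite exchange_big /=; congr (_ + _).
  case: (p) p0 => // r _; rewrite big_ord_recl /= subn0 big1 ?addr0 // => i _.
  by rewrite mul0r.
(* The simple poles are regrouped by their location [k], which turns the sum over [n] into [Dcoef]
   at [k]. *)
rewrite (exchange_big_dep xpredT) //=; apply: eq_bigr => k _.
rewrite mulr_suml; apply: eq_big => // n; by rewrite eq_sym.
Qed.

(** The coefficient of [(s - n)^i] in the binomial expansion of [s^-q] at [n]; hence [pole_part] is
    the principal part at [n] of [s^-q (s - n)^-m]. *)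
Definition invX_coef q i n : R := (-1) ^+ i * 'C((q + i).-1, i)%:R * n%:R ^- (q + i).

Definition pole_part q m n s : R := \sum_(i < m) invX_coef q i n * (s - n%:R) ^- (m - i).

Lemma pole_split q m n s : (0 < q + m)%N -> (0 < n)%N -> nonnat s ->
  s ^- q * (s - n%:R) ^- m = pole_part q m n s
    + \sum_(i < q) (-1) ^+ m * 'C((m + i).-1, i)%:R * n%:R ^- (m + i) * s ^- (q - i).
Proof.
move=> qm n0 ns; have s0 : s != 0 by exact: (ns 0).
have e : s - (s - n%:R) = n%:R by ring.
have d0 : s - (s - n%:R) != 0 by rewrite e pnatr_eq0 -lt0n.
have := @partial_fraction _ s (s - n%:R) q m s0 (nonnat_sub n ns) d0 qm.
by rewrite e.
Qed.

Definition Gtrunc p q N s : R := s ^- q * (Btrunc N s * Dtrunc p N s).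

Definition Gpart p q N n s : R := pole_part q p.+1 n s
  + \sum_(i < p) Bcoef N i n * pole_part q (p - i) n s + Dcoef p N n * pole_part q 1 n s.

Lemma pole_split_polar K q m n :
  (0 < m)%N -> (q <= K)%N -> (0 < n)%N -> exists2 f, polar K f &
    forall s, nonnat s -> s ^- q * (s - n%:R) ^- m = f s + pole_part q m n s.
Proof.
move=> m0 qK n0; eexists; last first.
  by move=> s ns; rewrite pole_split ?addn_gt0 ?m0 ?orbT // addrC.
apply: polar_sum => i _; apply: polarZ; apply: polar_inv.
by rewrite subn_gt0 ltn_ord (leq_trans (leq_subr _ _)).
Qed.

(** The terms of [B_N D_N] with pole at [0] only gain the factor [s^-q]; those with pole at [n >= 1]
    split by partial fractions, leaving at [0] a remainder of order at most [q]. *)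
Lemma Gtrunc_polar p q N : (0 < p)%N -> exists2 f, polar (p + q).+1 f &
  forall s, nonnat s -> Gtrunc p q N s = f s + \sum_(n < N) Gpart p q N n.+1 s.
Proof.
move=> p0; set K := (p + q).+1.
have qK : (q <= K)%N by rewrite /K; lia.
have main n : exists2 f, polar K f & forall s, nonnat s ->
  s ^- q * ((s - n.+1%:R) ^- p.+1 + \sum_(i < p) Bcoef N i n.+1 * (s - n.+1%:R) ^- (p - i)
    + Dcoef p N n.+1 * (s - n.+1%:R)^-1) = f s + Gpart p q N n.+1 s.
  have [f1 pf1 f1E] := @pole_split_polar K q p.+1 n.+1 isT qK isT.
  have [f2 pf2 f2E] := @pole_split_polar K q 1 n.+1 isT qK isT.
  have /choice[g gE] : forall i : 'I_p, exists f, polar K f /\ forall s, nonnat s ->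
      s ^- q * (s - n.+1%:R) ^- (p - i) = f s + pole_part q (p - i) n.+1 s.
    move=> i; have pi0 : (0 < p - i)%N by rewrite subn_gt0.
    by have [f ? ?] := @pole_split_polar K q (p - i) n.+1 pi0 qK isT; exists f.
  exists (fun s => f1 s + \sum_(i < p) Bcoef N i n.+1 * g i s + Dcoef p N n.+1 * f2 s).
    apply: polarD; last exact: polarZ.
    apply: polarD => //; apply: polar_sum => i _; apply: polarZ.
    by have [] := gE i.
  move=> s ns; rewrite !mulrDr f1E //.
  rewrite [s ^- q * (Dcoef _ _ _ * _)]mulrCA; have := f2E s ns; rewrite expr1 => ->.
  rewrite mulr_sumr (eq_bigr (fun i : 'I_p => Bcoef N i n.+1 * g i s
    + Bcoef N i n.+1 * pole_part q (p - i) n.+1 s)); last first.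
    by move=> i _; rewrite mulrCA; have [_ ->] := gE i; rewrite // mulrDr.
  by rewrite big_split /= /Gpart mulrDr; ring.
have /choice[g gE] : forall n : 'I_N, exists f, polar K f /\ forall s, nonnat s ->
  s ^- q * ((s - n.+1%:R) ^- p.+1 + \sum_(i < p) Bcoef N i n.+1 * (s - n.+1%:R) ^- (p - i)
    + Dcoef p N n.+1 * (s - n.+1%:R)^-1) = f s + Gpart p q N n.+1 s.
  by move=> n; have [f ? ?] := main n; exists f.
exists (fun s => (s ^- (q + p.+1) + \sum_(i < p) Bcoef N i 0 * s ^- (q + (p - i))
    + Dcoef p N 0 * s ^- (q + 1)) + \sum_(n < N) g n s).
  apply: polarD; last by apply: polar_sum => n _; have [] := gE n.
  apply: polarD; last by apply: polarZ; apply: polar_inv; rewrite /K; lia.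
  apply: polarD; first by apply: polar_inv; rewrite /K; lia.
  apply: polar_sum => i _; apply: polarZ; apply: polar_inv.
  by have := ltn_ord i; rewrite /K; lia.
move=> s ns; rewrite /Gtrunc Btrunc_Dtrunc // mulr_sumr big_ord_recl /= -[RHS]addrA.
congr (_ + _).
  rewrite subr0 !mulrDr !exprD !invfM expr1; congr (_ + _ + _); last by ring.
  rewrite mulr_sumr; apply: eq_bigr => i _; rewrite exprD invfM; ring.
rewrite -big_split /=; apply: eq_bigr => n _.
by have [_ <-] := gE n.
Qed.

Definition theta q m n : R := \sum_(i < m) invX_coef q i n * tau R (m - i).

Lemma cvg_series_pole_part q m n :
  series (fun k => pole_part q m n (half_int k) +
      pole_part q m n (- half_int k)) @ \oo --> theta q m n.
Proof.
have -> : (fun k => pole_part q m n (half_int k) + pole_part q m n (- half_int k)) =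
  (fun k => \sum_(i < m) invX_coef q i n * ((half_int k - n%:R) ^- (m - i) +
      (- half_int k - n%:R) ^- (m - i))).
  apply: funext => k; rewrite /pole_part -big_split.
  by apply: eq_bigr => i _; rewrite mulrDr.
apply: cvg_series_sum => i _; apply: cvg_series_scale.
by apply: cvg_series_pole; rewrite subn_gt0.
Qed.

(** No [Dcoef] term: it multiplies a simple pole, whose sum over the half-integers is
    [tau 1 = 0]. *)
Definition Gpart_tau p q N n : R := theta q p.+1 n +
    \sum_(i < p) Bcoef N i n * theta q (p - i) n.

Lemma cvg_series_Gpart p q N n :
  series (fun k => Gpart p q N n (half_int k) +
      Gpart p q N n (- half_int k)) @ \oo --> Gpart_tau p q N n.
Proof.
have -> : (fun k => Gpart p q N n (half_int k) + Gpart p q N n (- half_int k)) =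
  (fun k => (pole_part q p.+1 n (half_int k) + pole_part q p.+1 n (- half_int k))
    + \sum_(i < p) Bcoef N i n * (pole_part q (p - i) n (half_int k) +
      pole_part q (p - i) n (- half_int k))
    + Dcoef p N n * (pole_part q 1 n (half_int k) + pole_part q 1 n (- half_int k))).
  apply: funext => k; rewrite /Gpart; under [in RHS]eq_bigr do rewrite mulrDr.
  by rewrite big_split /=; ring.
have -> : Gpart_tau p q N n = theta q p.+1 n +
    \sum_(i < p) Bcoef N i n * theta q (p - i) n
    + Dcoef p N n * theta q 1 n.
  by rewrite [theta q 1 n]/theta big_ord1 tau1 !mulr0 addr0.
apply: cvg_series_add; last by apply: cvg_series_scale; exact: cvg_series_pole_part.
apply: cvg_series_add; first exact: cvg_series_pole_part.
apply: cvg_series_sum => i _; apply: cvg_series_scale; exact: cvg_series_pole_part.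
Qed.

(** [beta] and [delta] are the Taylor coefficients at [0] of [B_N - 1/s] and [D_N - s^-p], from the
    expansions of [(s - k)^-1] and [(s - k)^-p] in powers of [s/k]. *)
Definition beta N i : R := (if i is 0 then hnum R 1 N.+1 else 0) - Hnum R i.+1 N.
Definition delta p N i : R := (-1) ^+ p * 'C((p + i).-1, i)%:R * Hnum R (p + i) N.

(* The jets at [0] of [s * Btrunc N s] and [s ^+ p * Dtrunc p N s]; their product identifies
   the polar part of [Gtrunc p q N] at [0]. *)
Definition Upoly K N : {poly R} := 1 + \sum_(i < K) beta N i *: 'X^(i.+1).
Definition Vpoly p K N : {poly R} := 1 + \sum_(i < K) delta p N i *: 'X^(p + i).

Lemma nonnat_small (s : R) : 0 < s < 2^-1 -> nonnat s.
Proof.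
move=> /andP[s0 s1] [|k]; first by rewrite gt_eqF.
rewrite lt_eqF // (lt_le_trans s1) // (@le_trans _ _ 1) ?ler1n //; lra.
Qed.

Lemma bd_pole_part q m n : bd (pole_part q m n.+1).
Proof.
by apply: bd_sum => i _; apply: bdM; [exact: bd_cst|exact: bd_pole].
Qed.

(** Taylor's formula with exact remainder: it is the partial fraction of [s^-K (s - n)^-m]
    multiplied by [s^K], so the remainder is a combination of poles at [n] and is bounded near
    [0]. *)
Lemma pole_jet K m n (s : R) : (0 < m)%N -> 0 < s < 2^-1 ->
  (s - n.+1%:R) ^- m =
    \sum_(i < K) (-1) ^+ m * 'C((m + i).-1, i)%:R * n.+1%:R ^- (m + i) * s ^+ i
    + s ^+ K * pole_part K m n.+1 s.
Proof.
move=> m0 hs; have ns := nonnat_small hs; have s0 : s != 0 by exact: (ns 0).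
have := @pole_split K m n.+1 s; rewrite addn_gt0 m0 orbT => /(_ isT isT ns) e.
have sK : s ^+ K != 0 by rewrite expf_neq0.
apply: (mulfI (invr_neq0 sK)); rewrite e addrC mulrDr mulKf //; congr (_ + _).
rewrite mulr_sumr; apply: eq_bigr => i _; rewrite mulrCA; congr (_ * _).
by rewrite mulrC expr_divn_sub // ltnW.
Qed.

Lemma Btrunc_jet K N : (0 < K)%N -> exists2 u, bd u &
  forall s, 0 < s < 2^-1 -> s * Btrunc N s = (Upoly K N).[s] + s ^+ K * u s.
Proof.
move=> K0; exists (fun s => s ^+ 1 * \sum_(n < N) pole_part K 1 n.+1 s).
  apply: bdM; first exact: bd_exp.
  by apply: bd_sum => n _; exact: bd_pole_part.
move=> s hs; have s0 : s != 0 by exact: (nonnat_small hs 0).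
rewrite /Btrunc big_ord_recl subr0 mulrDr mulrDr mulfV //.
have -> : \sum_(n < N) (s - (lift ord0 n)%:R)^-1 =
    \sum_(n < N) (\sum_(i < K) - (n.+1%:R ^- i.+1 * s ^+ i) +
      s ^+ K * pole_part K 1 n.+1 s).
  apply: eq_bigr => n _; rewrite -[LHS]/((s - n.+1%:R)^-1) -[_ - _]expr1 (@pole_jet K) //.
  congr (_ + _); apply: eq_bigr => i _.
  by rewrite add1n /= binn expr1 mulr1 mulN1r mulNr.
rewrite big_split /= -mulr_sumr exchange_big /= /Upoly hornerD hornerC horner_sum expr1.
have -> : \sum_(i < K) (beta N i *: 'X^(i.+1)).[s] =
    \sum_(i < K) (s ^+ i.+1 * (if (i : nat) is 0 then hnum R 1 N.+1 else 0)
      + s * \sum_(n < N) - (n.+1%:R ^- i.+1 * s ^+ i)).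
  apply: eq_bigr => i _; rewrite hornerZ hornerXn /beta mulrC mulrBr; congr (_ + _).
  rewrite HnumE sumrN mulrN -mulr_suml exprS; ring.
rewrite big_split /= -mulr_sumr.
have -> : \sum_(i < K) s ^+ i.+1 * (if (i : nat) is 0 then hnum R 1 N.+1 else 0)
    = s * hnum R 1 N.+1.
  case: (K) K0 => // r _; rewrite big_ord_recl big1 ?addr0 ?expr1 // => i _.
  by rewrite mulr0.
ring.
Qed.

Lemma Dtrunc_jet p K N : (0 < p)%N -> exists2 v, bd v &
  forall s, 0 < s < 2^-1 -> s ^+ p * Dtrunc p N s = (Vpoly p K N).[s] + s ^+ K * v s.
Proof.
move=> p0; exists (fun s => s ^+ p * \sum_(n < N) pole_part K p n.+1 s).
  apply: bdM; first exact: bd_exp.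
  by apply: bd_sum => n _; exact: bd_pole_part.
move=> s hs; have s0 : s != 0 by exact: (nonnat_small hs 0).
rewrite /Dtrunc big_ord_recl subr0 mulrDr mulfV ?expf_neq0 //.
have -> : \sum_(n < N) (s - (lift ord0 n)%:R) ^- p = \sum_(n < N)
    (\sum_(i < K) (-1) ^+ p * 'C((p + i).-1, i)%:R * n.+1%:R ^- (p + i) * s ^+ i
      + s ^+ K * pole_part K p n.+1 s).
  by apply: eq_bigr => n _; exact: pole_jet.
rewrite big_split /= -mulr_sumr exchange_big /= /Vpoly hornerD hornerC horner_sum.
rewrite mulrDr mulrCA addrA; congr (_ + _ + _).
rewrite mulr_sumr; apply: eq_bigr => i _.
rewrite hornerZ hornerXn /delta HnumE exprD [LHS]mulr_sumr mulr_sumr mulr_suml.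
by apply: eq_bigr => n _; ring.
Qed.

(** With [K = p + q + 1], [s^K G_N] is [(s B_N)(s^p D_N)], so the unknown numerator [a] agrees with
    the product of the two jets below degree [K], which is all that [Lam] reads. *)
Lemma cvg_series_Gtrunc p q N : (0 < p)%N ->
  series (fun k => Gtrunc p q N (half_int k) + Gtrunc p q N (- half_int k)) @ \oo -->
    Lam (p + q).+1 (Upoly (p + q).+1 N * Vpoly p (p + q).+1 N)
    + \sum_(n < N) Gpart_tau p q N n.+1.
Proof.
move=> p0; have [f [a sa fa] fE] := @Gtrunc_polar p q N p0.
set K := (p + q).+1 in sa fa *.
have [u bu uE] := @Btrunc_jet K N isT; have [v bv vE] := @Dtrunc_jet p K N p0.
have aE i : (i < K)%N -> a`_i = (Upoly K N * Vpoly p K N)`_i.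
  move=> iK; apply/esym/eqP; rewrite -subr_eq0 -coefB; apply/eqP.
  apply: bd_coef0 iK.
  (* The bounded factor collects the principal parts at [1, ..., N] and the cross terms of the two
     jet remainders. *)
  exists (fun s => \sum_(n < N) Gpart p q N n.+1 s
     + -1 * (u s * (Vpoly p K N).[s] + v s * (Upoly K N).[s] + s ^+ K * (u s * v s))).
    apply: bdD.
      apply: bd_sum => n _; apply: bdD; last
        by apply: bdM; [exact: bd_cst|exact: bd_pole_part].
      apply: bdD; first exact: bd_pole_part.
      by apply: bd_sum => j _; apply: bdM; [exact: bd_cst|exact: bd_pole_part].
    apply: bdM; first exact: bd_cst.
    apply: bdD; last by apply: bdM; [exact: bd_exp|exact: bdM].
    by apply: bdD; apply: bdM => //; exact: bd_horner.
  move=> s hs; have ns := nonnat_small hs; have s0 : s != 0 by exact: (ns 0).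
  have sK : s ^+ K != 0 by rewrite expf_neq0.
  have e : s ^+ K * Gtrunc p q N s = (s * Btrunc N s) * (s ^+ p * Dtrunc p N s).
    rewrite /Gtrunc /K exprS exprD; field; by rewrite expf_neq0.
  have e2 : s ^+ K * f s = a.[s] by rewrite fa // mulrC divfK.
  have hB (P Q A : {poly R}) x : (P * Q - A).[x] = P.[x] * Q.[x] - A.[x].
    by rewrite hornerD hornerN hornerM.
  move: e; rewrite fE // mulrDr e2 uE // vE // hB => e.
  by have -> : a.[s] = ((Upoly K N).[s] + s ^+ K * u s) * ((Vpoly p K N).[s] +
      s ^+ K * v s)
     - s ^+ K * (\sum_(n < N) Gpart p q N n.+1 s); [rewrite -e; ring | ring].
have -> : Lam K (Upoly K N * Vpoly p K N) = Lam K a.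
  by apply: eq_bigr => i _; rewrite aE.
have h0 n : half_int n != 0 by rewrite gt_eqF ?half_int_gt0.
have -> : (fun k => Gtrunc p q N (half_int k) + Gtrunc p q N (- half_int k)) =
  (fun k => (a.[half_int k] / half_int k ^+ K + a.[- half_int k] / (- half_int k) ^+ K)
    + \sum_(n < N) (Gpart p q N n.+1 (half_int k) + Gpart p q N n.+1 (- half_int k))).
  apply: funext => k; rewrite !fE; [|exact: nonnat_half_intN|exact: nonnat_half_int].
  by rewrite !fa ?oppr_eq0 // addrACA -big_split.
apply: cvg_series_add; first exact: cvg_series_polar.
by apply: cvg_series_sum => n _; exact: cvg_series_Gpart.
Qed.

(** Monomials of degree at least [K] cost nothing: truncated subtraction sends them to
    [tau 0 = 0]. *)
Lemma Lam_UV p q N : let K := (p + q).+1 in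
  Lam K (Upoly K N * Vpoly p K N) = tau R K
    + \sum_(i < K) beta N i * tau R (p + q - i)
    + \sum_(l < K) delta p N l * tau R (q + 1 - l)
    + \sum_(i < K) \sum_(l < K) beta N i * delta p N l * tau R (q - i - l).
Proof.
move=> K; rewrite /Upoly /Vpoly mulrDl mul1r mulrDr mulr1.
rewrite !LamD !Lam_sum -addrA -addrA.
have -> : Lam K 1 = tau R K by rewrite -(expr0 'X) Lam_X subn0.
rewrite -!addrA; congr (_ + _); rewrite [RHS]addrCA; congr (_ + _).
  by apply: eq_bigr => l _; rewrite LamZ Lam_X; congr (_ * tau R _); rewrite /K; lia.
congr (_ + _).
  by apply: eq_bigr => l _; rewrite LamZ Lam_X; congr (_ * tau R _); rewrite /K; lia.
rewrite mulr_suml Lam_sum; apply: eq_bigr => i _.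
rewrite mulr_sumr Lam_sum; apply: eq_bigr => l _.
rewrite -scalerAl -scalerAr scalerA -exprD LamZ Lam_X.
by congr (_ * tau R _); rewrite /K; lia.
Qed.

End Kernel.

(** * The kernel at half-integers: limits and bounds uniform in [N] *)

Section Limits.
Variable R : realType.
Local Notation half_int := (@half_int R).

Lemma sum_neq_split (F : nat -> R) n M :
  \sum_(k < (n + M).+1 | (k : nat) != n) F k
    = \sum_(k < n) F k + \sum_(j < M) F (n + j.+1)%N.
Proof.
rewrite big_mkcond; elim: M => [|M IH].
  rewrite big_ord0 addr0 addn0 big_ord_recr /= eqxx addr0.
  by apply: eq_bigr => i _; rewrite ltn_eqF.
rewrite addnS big_ord_recr IH [in RHS]big_ord_recr /= addrA addnS; congr (_ + _).
by rewrite gtn_eqF // ltnS leq_addr.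
Qed.

(** Indices below [n] give [n - k > 0] and keep the sign [(-1)^i]; indices above give
    [(-1)^i (-1)^(i+1) = -1]. *)
Lemma BcoefE N i n : (n <= N)%N -> Bcoef R N i n =
  (if i is 0 then hnum R 1 N.+1 else 0) + (-1) ^+ i * Hnum R i.+1 n
    - Hnum R i.+1 (N - n).
Proof.
move=> /subnKC <-; move: (N - n)%N => M; rewrite addKn /Bcoef -addrA; congr (_ + _).
rewrite (sum_neq_split (fun k => (-1) ^+ i * (n%:R - k%:R) ^- i.+1)) !HnumE -sumrN.
rewrite mulr_sumr; congr (_ + _).
  rewrite (reindex_inj rev_ord_inj) /=; apply: eq_bigr => k _.
  by rewrite natrB // opprB addrC subrK.
apply: eq_bigr => j _; rewrite natrD opprD addrA subrr add0r invXN mulrA.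
by rewrite -exprD addnS exprS addnn -mul2n exprM sqrrN expr1n expr1n mulr1 mulN1r.
Qed.

Lemma sum_half_int_add p n M : \sum_(k < M) half_int (n + k) ^- p =
    hnum R p (n + M) - hnum R p n.
Proof.
elim: M => [|M IH]; first by rewrite big_ord0 addn0 subrr.
by rewrite big_ord_recr /= IH addnS hnumS; ring.
Qed.

(** The argument changes sign after [k = n]. Truncated subtraction merges the cases: before that
    point the last term is [0], after it the middle one is. *)
Lemma sum_half_int_sub p n M : \sum_(k < M) (half_int n - k%:R) ^- p =
  hnum R p n.+1 - hnum R p (n.+1 - M) + (-1) ^+ p * hnum R p (M - n.+1).
Proof.
elim: M => [|M IH]; first by rewrite big_ord0 subn0 hnum0 mulr0 subrr addr0.
rewrite big_ord_recr /= IH; have [Mn|nM] := leqP M n.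
  have /eqP -> : (M.+1 - n.+1 == 0)%N by rewrite subn_eq0.
  have /eqP -> : (M - n.+1 == 0)%N by rewrite subn_eq0 leqW.
  have -> : half_int n - M%:R = half_int (n - M)
      by rewrite -{1}(subnK Mn) half_int_addn addrK.
  by rewrite subSn // [hnum R p (n - M).+1]hnumS subSS; ring.
have /eqP -> : (n.+1 - M == 0)%N by rewrite subn_eq0.
have /eqP -> : (n.+1 - M.+1 == 0)%N by rewrite subn_eq0 leqW.
rewrite subSn // [hnum R p (M - n.+1).+1]hnumS; have -> : half_int n - M%:R =
    - half_int (M - n.+1).
  by rewrite -[in LHS](subnK nM); move: (M - n.+1)%N => D; rewrite /half_int natrD; lra.
rewrite invXN; ring.
Qed.

Lemma Dtrunc_half_intN p N n :
  Dtrunc p N (- half_int n) = (-1) ^+ p * (hnum R p (n + N.+1) - hnum R p n).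
Proof.
rewrite -sum_half_int_add mulr_sumr; apply: eq_bigr => k _.
by rewrite -opprD -half_int_addn invXN.
Qed.

Lemma Btrunc_half_intN N n :
  Btrunc N (- half_int n) = hnum R 1 N.+1 - (hnum R 1 (n + N.+1) - hnum R 1 n).
Proof.
rewrite -sum_half_int_add -sumrN; congr (_ + _); apply: eq_bigr => k _.
by rewrite -opprD -half_int_addn expr1 invrN.
Qed.

Lemma Dtrunc_half_int p N n : Dtrunc p N (half_int n) =
  hnum R p n.+1 - hnum R p (n - N) + (-1) ^+ p * hnum R p (N - n).
Proof. exact: sum_half_int_sub. Qed.

Lemma Btrunc_half_int N n : Btrunc N (half_int n) =
  hnum R 1 N.+1 + (hnum R 1 n.+1 - hnum R 1 (n - N) - hnum R 1 (N - n)).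
Proof.
by rewrite /Btrunc; congr (_ + _); have := sum_half_int_sub 1 n N.+1;
    rewrite expr1 mulN1r subSS.
Qed.

Lemma cvg_shiftn_r (u : nat -> R) k (l : R) : u @ \oo --> l -> u (n + k)%N @[n
    --> \oo] --> l.
Proof. by rewrite -(@cvg_shiftn k R u). Qed.

Lemma cvg_hnum_addn k : hnum R 1 (n + k) - hnum R 1 n @[n --> \oo] --> (0 : R).
Proof.
elim: k => [|k IH].
  by under eq_fun do rewrite addn0 subrr; exact: cvg_cst.
have -> : (fun n => hnum R 1 (n + k.+1) - hnum R 1 n) =
  (fun n => (hnum R 1 (n + k) - hnum R 1 n) + half_int (n + k) ^- 1).
  by apply: funext => n; rewrite addnS hnumS; ring.
rewrite -[X in _ --> X]addr0; apply: cvgD => //.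
exact: (@cvg_shiftn_r (fun n => half_int n ^- 1) k 0 (@cvg_half_int_invX R 1 isT)).
Qed.

Lemma cvg_Btrunc_half_intN n : Btrunc N (- half_int n) @[N --> \oo] --> hnum R 1 n.
Proof.
have -> : (fun N => Btrunc N (- half_int n)) =
    (fun N => hnum R 1 n - (hnum R 1 (N.+1 + n) - hnum R 1 N.+1)).
  by apply: funext => N; rewrite Btrunc_half_intN addnC; ring.
rewrite -[X in _ --> X]subr0; apply: cvgB; first exact: cvg_cst.
have := @cvg_shiftn_r (fun N => hnum R 1 (N + n) - hnum R 1 N) 1 0 (@cvg_hnum_addn n).
by under eq_fun do rewrite addn1.
Qed.

Lemma cvg_Btrunc_half_int n : Btrunc N (half_int n) @[N --> \oo] --> hnum R 1 n.+1.
Proof.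
apply: (@cvg_addn _ n (fun N => Btrunc N (half_int n))).
have -> : (fun N => Btrunc (N + n) (half_int n)) =
    (fun N => hnum R 1 n.+1 + (hnum R 1 (N + n.+1) - hnum R 1 N)).
  apply: funext => N; rewrite Btrunc_half_int addnK addnS.
  have /eqP -> : (n - (N + n) == 0)%N by rewrite subn_eq0 leq_addl.
  by rewrite hnum0; ring.
rewrite -[X in _ --> X]addr0; apply: cvgD; first exact: cvg_cst.
exact: cvg_hnum_addn.
Qed.

Lemma cvg_Dtrunc_half_intN p n : (1 < p)%N ->
  Dtrunc p N (- half_int n) @[N --> \oo] --> (-1) ^+ p * (ttilde R p - hnum R p n).
Proof.
move=> p1; have -> : (fun N => Dtrunc p N (- half_int n)) =
    (fun N => (-1) ^+ p * (hnum R p (N + n.+1) - hnum R p n)).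
  by apply: funext => N; rewrite Dtrunc_half_intN addnC addSnnS.
apply: cvgM; first exact: cvg_cst.
apply: cvgB; last exact: cvg_cst.
exact: (@cvg_shiftn_r (hnum R p) n.+1 _ (@cvg_hnum R p p1)).
Qed.

Lemma cvg_Dtrunc_half_int p n : (1 < p)%N ->
  Dtrunc p N (half_int n) @[N --> \oo] --> hnum R p n.+1 + (-1) ^+ p * ttilde R p.
Proof.
move=> p1; apply: (@cvg_addn _ n (fun N => Dtrunc p N (half_int n))).
have -> : (fun N => Dtrunc p (N + n) (half_int n)) =
    (fun N => hnum R p n.+1 + (-1) ^+ p * hnum R p N).
  apply: funext => N; rewrite Dtrunc_half_int addnK.
  have /eqP -> : (n - (N + n) == 0)%N by rewrite subn_eq0 leq_addl.
  by rewrite hnum0 subr0.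
apply: cvgD; first exact: cvg_cst.
by apply: cvgM; [exact: cvg_cst|exact: cvg_hnum].
Qed.

Lemma normr_signM n (x : R) : `|(-1) ^+ n * x| = `|x|.
Proof. by rewrite normrM normrX normrN1 expr1n mul1r. Qed.

(** Each [h] with an index depending on [N] diverges; subadditivity bounds their difference by an
    [h] of index [n]. *)
Lemma Btrunc_half_intN_le N n : `|Btrunc N (- half_int n)| <= 2 * hnum R 1 n.+1.
Proof.
have h1 := hnum1_sub R n N.+1.
have h2 := @hnum_mono R 1 N.+1 (n + N.+1) (leq_addl _ _).
have h3 := @hnum_mono R 1 n n.+1 (leqnSn _); have h4 := hnum_ge0 R 1 n.
by rewrite Btrunc_half_intN ler_norml; apply/andP; split; lra.
Qed.

Lemma Btrunc_half_int_le N n : `|Btrunc N (half_int n)| <= 2 * hnum R 1 n.+1.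
Proof.
rewrite Btrunc_half_int; have h0 := hnum_ge0 R 1 N.+1.
have [Nn|nN] := leqP N n.
  have /eqP -> : (N - n == 0)%N by rewrite subn_eq0.
  have h1 := @hnum_mono R 1 N.+1 n.+1 Nn.
  have h2 : hnum R 1 (n - N) <= hnum R 1 n.+1.
    by apply: hnum_mono; rewrite (leq_trans (leq_subr _ _)).
  have h3 := hnum_ge0 R 1 (n - N).
  by rewrite hnum0 ler_norml; apply/andP; split; lra.
have /eqP -> : (n - N == 0)%N by rewrite subn_eq0 ltnW.
have h1 : hnum R 1 N.+1 <= hnum R 1 (N - n) + hnum R 1 n.+1.
  have <- : (N - n + n.+1 = N.+1)%N by rewrite addnS subnK // ltnW.
  exact: hnum1_sub.
have h2 : hnum R 1 (N - n) <= hnum R 1 N.+1.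
  by apply: hnum_mono; rewrite (leq_trans (leq_subr _ _)).
have h3 := hnum_ge0 R 1 n.+1.
by rewrite hnum0 ler_norml; apply/andP; split; lra.
Qed.

Lemma Dtrunc_half_intN_le p N n : (1 < p)%N -> `|Dtrunc p N (- half_int n)| <=
    2 * ttilde R p.
Proof.
move=> p1; rewrite Dtrunc_half_intN normr_signM.
have h1 := hnum_le_ttilde R (n + N.+1) p1; have h2 := hnum_le_ttilde R n p1.
have h3 := hnum_ge0 R p n; have h4 := hnum_ge0 R p (n + N.+1).
by rewrite ler_norml; apply/andP; split; lra.
Qed.

Lemma Dtrunc_half_int_le p N n : (1 < p)%N -> `|Dtrunc p N (half_int n)| <=
    2 * ttilde R p.
Proof.
move=> p1; rewrite Dtrunc_half_int; apply: le_trans (ler_normD _ _) _.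
rewrite normr_signM (ger0_norm (hnum_ge0 _ _ _)).
have h1 := hnum_le_ttilde R n.+1 p1; have h2 := hnum_le_ttilde R (N - n) p1.
have h3 := hnum_ge0 R p (n - N).
have h4 : hnum R p (n - N) <= hnum R p n.+1.
  by apply: hnum_mono; rewrite (leq_trans (leq_subr _ _)).
by rewrite ger0_norm; lra.
Qed.

Lemma invX_Hnum_harmonic_dom n q : (1 < q)%N -> Hnum R 1 n.+1 * n.+1%:R ^- q <=
    harmonic_dom R n.
Proof.
move=> q1; rewrite /harmonic_dom ler_wpM2l ?Hnum_ge0 //.
by rewrite lef_pV2 ?posrE ?exprn_gt0 // ler_weXn2l // ler1n.
Qed.

Lemma half_int_hnum_harmonic_dom n q : (1 < q)%N -> hnum R 1 n.+1 *
    half_int n ^- q <= 2 ^+ q.+1 * harmonic_dom R n.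
Proof.
move=> q1; have -> : 2 ^+ q.+1 * harmonic_dom R n =
    2 * (2 ^+ q * harmonic_dom R n) by rewrite exprS mulrA.
apply: (@le_trans _ _ ((2 * Hnum R 1 n.+1) * (2 ^+ q * n.+1%:R ^- q))).
  apply: ler_pM; rewrite ?hnum_ge0 ?hnum1_le ?half_int_inv_le //.
  by rewrite invr_ge0 exprn_ge0 // ltW // half_int_gt0.
rewrite -mulrA ler_wpM2l // mulrCA ler_wpM2l ?exprn_ge0 //.
exact: invX_Hnum_harmonic_dom.
Qed.

(** The [8] comes from two points, with a factor [2] for [B_N] and a factor [2] for [D_N] at
    each. *)
Lemma Gtrunc_le p q N n : (1 < p)%N -> (1 < q)%N ->
  `|Gtrunc p q N (half_int n) + Gtrunc p q N (- half_int n)| <=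
      8 * ttilde R p * 2 ^+ q.+1 * harmonic_dom R n.
Proof.
move=> p1 q1; apply: le_trans (ler_normD _ _) _; rewrite /Gtrunc.
have h0 : 0 <= half_int n ^- q by rewrite invr_ge0 exprn_ge0 // ltW // half_int_gt0.
rewrite invXN -[_ * _ ^- q * _]mulrA normr_signM !normrM !(ger0_norm h0).
have b1 : `|Btrunc N (half_int n)| * `|Dtrunc p N (half_int n)| <=
    (2 * hnum R 1 n.+1) * (2 * ttilde R p).
  by rewrite ler_pM // ?Btrunc_half_int_le ?Dtrunc_half_int_le.
have b2 : `|Btrunc N (- half_int n)| * `|Dtrunc p N (- half_int n)| <=
    (2 * hnum R 1 n.+1) * (2 * ttilde R p).
  by rewrite ler_pM // ?Btrunc_half_intN_le ?Dtrunc_half_intN_le.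
rewrite -mulrDr.
apply: (@le_trans _ _ (8 * ttilde R p * (hnum R 1 n.+1 * half_int n ^- q))).
  have -> : 8 * ttilde R p * (hnum R 1 n.+1 * half_int n ^- q) = half_int n ^- q *
    ((2 * hnum R 1 n.+1) * (2 * ttilde R p) + (2 * hnum R 1 n.+1) * (2 * ttilde R p)).
    by ring.
  by rewrite ler_wpM2l // lerD.
rewrite -[leRHS]mulrA ler_wpM2l ?half_int_hnum_harmonic_dom // mulr_ge0 //;
    apply: le_trans (hnum_le_ttilde R 0 p1); exact: hnum_ge0.
Qed.

End Limits.

(** * Passage to the limit in [N] on both sides *)

Section Identity.
Variable R : realType.
Local Notation half_int := (@half_int R).

Lemma hnum_sub_Hnum_mono :
  {homo (fun n => hnum R 1 n - Hnum R 1 n) : m n / (m <= n)%N >-> m <= n}.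
Proof.
apply: homo_leq; [exact: lexx|by move=> y x z; exact: le_trans|move=> n].
have : n.+1%:R ^- 1 <= half_int n ^- 1.
  by rewrite !expr1 lef_pV2 ?posrE ?half_int_gt0 // /half_int gerBl invr_ge0.
rewrite hnumS HnumS; move: (n.+1%:R ^- 1) (half_int n ^- 1) => a b; lra.
Qed.

Lemma hnum_sub_Hnum_bounds n : 0 <= hnum R 1 n - Hnum R 1 n <= 2 * ln 2.
Proof.
apply/andP; split.
  by have := @hnum_sub_Hnum_mono 0 n (leq0n _); rewrite hnum0 Hnum0 subrr.
apply: (ler_cvg_to (cvg_cst (hnum R 1 n - Hnum R 1 n)) (@cvg_hnum_sub_Hnum R)).
by exists n => // m /= nm; exact: hnum_sub_Hnum_mono.
Qed.

Lemma Bcoef_le i : exists C, forall N n, (n < N)%N ->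
  `|Bcoef R N i n.+1| <= C * Hnum R 1 n.+1.
Proof.
case: i => [|i].
  (* The coefficient is [(h_{N+1} - H_{N+1}) + H_{n+1} + (H_{N+1} - H_{N-n-1})]: at most [2 log 2]
     for the first bracket and [H_{n+1} + 1] for the last, and [1 <= H_{n+1}] absorbs the
     constants. *)
  exists (2 * ln 2 + 3) => N n nN; rewrite BcoefE // expr0 mul1r.
  have h1 := Hnum1_ge1 R n; have /andP[h2 h3] := hnum_sub_Hnum_bounds N.+1.
  have h4 : Hnum R 1 N.+1 <= Hnum R 1 (N - n.+1) + Hnum R 1 n.+2.
    have <- : (N - n.+1 + n.+2 = N.+1)%N by rewrite addnS subnK.
    exact: Hnum1_sub.
  have h5 : Hnum R 1 n.+2 <= Hnum R 1 n.+1 + 1.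
    rewrite HnumS lerD2l expr1 invf_le1 // ler1n //.
  have h6 : Hnum R 1 (N - n.+1) <= Hnum R 1 N.+1.
    by apply: Hnum_mono; rewrite (leq_trans (leq_subr _ _)).
  have h7 : 0 <= ln (2 : R) by rewrite ln_ge0 // ler1n.
  have h8 : 2 * ln 2 <= 2 * ln 2 * Hnum R 1 n.+1 by rewrite ler_peMr // mulr_ge0.
  by rewrite ler_norml; apply/andP; split; lra.
exists (1 + zeta R i.+2) => N n nN; rewrite BcoefE // add0r.
apply: le_trans (ler_normB _ _) _; rewrite normr_signM !ger0_norm ?Hnum_ge0 //.
rewrite mulrDl mul1r lerD ?Hnum_leHnum1 //.
apply: (@le_trans _ _ (zeta R i.+2)); first exact: Hnum_le_zeta.
rewrite ler_peMr ?Hnum1_ge1 //.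
by apply: le_trans (Hnum_le_zeta R 0 _); rewrite ?Hnum_ge0.
Qed.

Lemma theta_le q m : (1 < q)%N ->
  exists C, forall n, `|theta R q m n.+1| <= C * n.+1%:R ^- 2.
Proof.
move=> q1; exists (\sum_(i < m) 'C((q + i).-1, i)%:R * `|tau R (m - i)|) => n.
apply: le_trans (ler_norm_sum _ _ _) _; rewrite mulr_suml; apply: ler_sum => i _.
rewrite /invX_coef -!mulrA normr_signM !normrM normr_nat ler_wpM2l // mulrC ler_wpM2l //.
rewrite ger0_norm ?invr_ge0 ?exprn_ge0 //.
rewrite lef_pV2 ?posrE ?exprn_gt0 // ler_weXn2l // ?ler1n //.
by rewrite (leq_trans q1) // leq_addr.
Qed.

Lemma Gpart_tau_le p q : (1 < q)%N -> exists C, forall N n, (n < N)%N ->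
  `|Gpart_tau R p q N n.+1| <= C * harmonic_dom R n.
Proof.
move=> q1; have [C0 C0E] := theta_le p.+1 q1.
have /choice[b bE] : forall i, exists C, forall N n, (n < N)%N ->
  `|Bcoef R N i n.+1| <= C * Hnum R 1 n.+1 by exact: Bcoef_le.
have /choice[t tE] : forall m, exists C, forall n,
  `|theta R q m n.+1| <= C * n.+1%:R ^- 2 by move=> m; exact: theta_le.
have C0_ge0 : 0 <= C0.
  by have := C0E 0; rewrite expr1n invr1 mulr1; exact: le_trans.
exists (C0 + \sum_(i < p) b i * t (p - i)%N) => N n nN.
apply: le_trans (ler_normD _ _) _; rewrite mulrDl lerD //.
  apply: le_trans (C0E n) _; rewrite ler_wpM2l // /harmonic_dom.
  by rewrite ler_peMl ?Hnum1_ge1 // invr_ge0 exprn_ge0.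
apply: le_trans (ler_norm_sum _ _ _) _; rewrite mulr_suml; apply: ler_sum => i _.
rewrite normrM; have -> : b i * t (p - i)%N * harmonic_dom R n
  = (b i * Hnum R 1 n.+1) * (t (p - i)%N * n.+1%:R ^- 2) by rewrite /harmonic_dom; ring.
by rewrite ler_pM // ?bE ?tE.
Qed.

Definition Bcoef_lim i n : R := if i is 0 then 2 * ln 2 + Hnum R 1 n
  else (-1) ^+ i * Hnum R i.+1 n - zeta R i.+1.

Lemma cvg_Bcoef i n : Bcoef R N i n @[N --> \oo] --> Bcoef_lim i n.
Proof.
apply: (@cvg_addn _ n (fun N => Bcoef R N i n)).
have -> : (fun N => Bcoef R (N + n) i n) = (fun N =>
  (if i is 0 then hnum R 1 (N + n).+1 else 0) +
      (-1) ^+ i * Hnum R i.+1 n - Hnum R i.+1 N).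
  by apply: funext => N; rewrite BcoefE ?leq_addl // addnK.
case: i => [|i] /=.
  have -> : (fun N => hnum R 1 (N + n).+1 + (-1) ^+ 0 * Hnum R 1 n - Hnum R 1 N) =
    (fun N => (hnum R 1 N - Hnum R 1 N) + (hnum R 1 (N + n.+1) - hnum R 1 N) +
      Hnum R 1 n).
    by apply: funext => N; rewrite addnS expr0; ring.
  rewrite -[2 * _]addr0; apply: cvgD; last exact: cvg_cst.
  by apply: cvgD; [exact: cvg_hnum_sub_Hnum|exact: cvg_hnum_addn].
apply: cvgB; last exact: cvg_Hnum.
by rewrite -[X in _ --> X]add0r; apply: cvgD; exact: cvg_cst.
Qed.

Definition Gpart_lim p q n : R := theta R q p.+1 n +
    \sum_(i < p) Bcoef_lim i n * theta R q (p - i) n.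

Lemma cvg_Gpart_tau p q n : Gpart_tau R p q N n @[N --> \oo] --> Gpart_lim p q n.
Proof.
apply: cvgD; first exact: cvg_cst.
apply: cvg_sumr => i _; apply: cvgM; [exact: cvg_Bcoef|exact: cvg_cst].
Qed.

Lemma cvg_sum_Gpart_tau p q : (1 < q)%N ->
  \sum_(n < N) Gpart_tau R p q N n.+1 @[N --> \oo]
      --> limn (series (fun n => Gpart_lim p q n.+1)).
Proof.
move=> q1; have [C CE] := Gpart_tau_le p q1.
(* Extension by [0] turns the finite sum, whose length grows with [N], into a series to which
   [tannery] applies. *)
pose w N n : R := if (n < N)%N then Gpart_tau R p q N n.+1 else 0.
have C0 : 0 <= C.
  have := CE 1 0 isT; rewrite /harmonic_dom expr1n divr1 HnumS Hnum0 add0r expr1 invr1 mulr1.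
  exact: le_trans.
have dom0 n : 0 <= harmonic_dom R n by rewrite divr_ge0 ?Hnum_ge0 ?exprn_ge0.
apply: (@tannery _ w _ (fun n => C * harmonic_dom R n)).
- move=> n; apply: (@cvg_addn _ n.+1 (fun N => w N n)).
  have -> : (fun N => w (N + n.+1)%N n) = (fun N => Gpart_tau R p q (N + n.+1) n.+1).
    by apply: funext => N; rewrite /w leq_addl.
  exact: (@cvg_shiftn_r R (fun N => Gpart_tau R p q N n.+1) n.+1 _ (@cvg_Gpart_tau p q n.+1)).
- move=> N n; rewrite /w; case: ifP => [nN|_]; first exact: CE.
  by rewrite normr0 mulr_ge0.
- exact: cvg_harmonic_domZ.
- move=> N; apply: (@cvg_addn _ N (series (w N))).
  have -> : (fun n => series (w N) (n + N)%N) =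
      (fun=> \sum_(n < N) Gpart_tau R p q N n.+1).
    apply: funext => n; rewrite /series /= big_mkord addnC big_split_ord /=.
    rewrite [X in _ + X]big1 ?addr0.
      by apply: eq_bigr => i _; rewrite /w ltn_ord.
    by move=> i _; rewrite /w ltnNge leq_addr.
  exact: cvg_cst.
Qed.

Definition beta_lim i : R := if i is 0 then 2 * ln 2 else - zeta R i.+1.
Definition delta_lim p l : R := (-1) ^+ p * 'C((p + l).-1, l)%:R * zeta R (p + l).

Lemma cvg_beta i : beta R N i @[N --> \oo] --> beta_lim i.
Proof.
case: i => [|i].
  have -> : (fun N => beta R N 0) =
    (fun N => (hnum R 1 N - Hnum R 1 N) + (hnum R 1 (N + 1) - hnum R 1 N)).
    by apply: funext => N; rewrite /beta addn1; ring.
  rewrite /beta_lim -[2 * _]addr0.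
  by apply: cvgD; [exact: cvg_hnum_sub_Hnum|exact: cvg_hnum_addn].
rewrite /beta_lim -[- zeta _ _]add0r.
by apply: cvgB; [exact: cvg_cst|exact: cvg_Hnum].
Qed.

Lemma cvg_delta p l : (1 < p)%N -> delta R p N l @[N --> \oo] --> delta_lim p l.
Proof.
move=> p1; apply: cvgM; first exact: cvg_cst.
by apply: cvg_Hnum; rewrite (leq_trans p1) // leq_addr.
Qed.

Definition Lam_lim p q : R := tau R (p + q).+1
    + \sum_(i < (p + q).+1) beta_lim i * tau R (p + q - i)
    + \sum_(l < (p + q).+1) delta_lim p l * tau R (q + 1 - l)
    + \sum_(i < (p + q).+1) \sum_(l < (p + q).+1)
        beta_lim i * delta_lim p l * tau R (q - i - l).

Lemma cvg_Lam p q : (1 < p)%N ->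
  Lam (p + q).+1 (Upoly R (p + q).+1 N * Vpoly R p (p + q).+1 N)
    @[N --> \oo] --> Lam_lim p q.
Proof.
move=> p1; under eq_fun do rewrite Lam_UV.
apply: cvgD; first apply: cvgD; first apply: cvgD; first exact: cvg_cst.
- by apply: cvg_sumr => i _; apply: cvgM; [exact: cvg_beta|exact: cvg_cst].
- by apply: cvg_sumr => i _; apply: cvgM; [exact: cvg_delta|exact: cvg_cst].
- apply: cvg_sumr => i _; apply: cvg_sumr => l _; apply: cvgM; last exact: cvg_cst.
  by apply: cvgM; [exact: cvg_beta|exact: cvg_delta].
Qed.

Definition Gpair_lim p q n : R :=
  half_int n ^- q * (hnum R 1 n.+1 * (hnum R p n.+1 + (-1) ^+ p * ttilde R p))
  + (- half_int n) ^- q * (hnum R 1 n * ((-1) ^+ p * (ttilde R p - hnum R p n))).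

(** The closed form of the sum of [G_N] over half-integers converges to the left side by [tannery],
    and to the right side term by term; the limit is unique. *)
Lemma lim_series_Gpair_lim p q : (1 < p)%N -> (1 < q)%N ->
  limn (series (Gpair_lim p q)) =
      Lam_lim p q + limn (series (fun n => Gpart_lim p q n.+1)).
Proof.
move=> p1 q1.
have h1 : Lam (p + q).+1 (Upoly R (p + q).+1 N * Vpoly R p (p + q).+1 N)
    + \sum_(n < N) Gpart_tau R p q N n.+1 @[N --> \oo] --> limn (series (Gpair_lim p q)).
  apply: (@tannery _ (fun N n => Gtrunc p q N (half_int n) +
      Gtrunc p q N (- half_int n)) (Gpair_lim p q)
    (fun n => 8 * ttilde R p * 2 ^+ q.+1 * harmonic_dom R n)).
  - move=> n; apply: cvgD; (apply: cvgM; [exact: cvg_cst|apply: cvgM]).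
    + exact: cvg_Btrunc_half_int.
    + exact: cvg_Dtrunc_half_int.
    + exact: cvg_Btrunc_half_intN.
    + exact: cvg_Dtrunc_half_intN.
  - by move=> N n; exact: Gtrunc_le.
  - exact: cvg_harmonic_domZ.
  - by move=> N; apply: cvg_series_Gtrunc; exact: ltnW.
rewrite -[LHS](cvg_lim (@Rhausdorff R) h1).
by apply: cvg_lim => //; apply: cvgD; [exact: cvg_Lam|exact: cvg_sum_Gpart_tau].
Qed.

Lemma cvg_series_half_int q (u : nat -> R) C : (1 < q)%N ->
  (forall n, `|u n| <= C * hnum R 1 n.+1) -> cvgn (series (fun n => u n / half_int n ^+ q)).
Proof.
move=> q1 uC.
apply: (series_dominated_cvg _ (@cvg_harmonic_domZ R (C * 2 ^+ q.+1))) => n.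
have h0 : 0 <= half_int n ^- q by rewrite invr_ge0 exprn_ge0 // ltW // half_int_gt0.
have C0 : 0 <= C.
  have := uC 0; have : 0 < hnum R 1 1.
    by rewrite hnumS hnum0 add0r expr1 invr_gt0 half_int_gt0.
  by move=> p0 /(le_trans (normr_ge0 _)); rewrite pmulr_lge0.
rewrite normrM (ger0_norm h0) -mulrA.
apply: le_trans (ler_wpM2l C0 (half_int_hnum_harmonic_dom R n q1)).
by rewrite mulrA ler_wpM2r.
Qed.

Lemma cvg_EulerT1 p q : (1 < p)%N -> (1 < q)%N ->
  series (fun n => hnum R 1 n * hnum R p n / half_int n ^+ q) @ \oo --> EulerT1 R p q.
Proof.
move=> p1 q1; apply: (@cvg_series_half_int q _ (ttilde R p)) => // n.
rewrite normrM !ger0_norm ?hnum_ge0 // mulrC ler_pM ?hnum_ge0 ?hnum_le_ttilde //.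
exact: hnum_mono.
Qed.

Lemma cvg_EulerT_1 q : (1 < q)%N ->
  series (fun n => hnum R 1 n / half_int n ^+ q) @ \oo --> EulerT R 1 q.
Proof.
move=> q1; apply: (@cvg_series_half_int q _ 1) => // n.
by rewrite ger0_norm ?hnum_ge0 // mul1r; exact: hnum_mono.
Qed.

Lemma hnum1_ge1 n : 1 <= hnum R 1 n.+1.
Proof.
apply: (@le_trans _ _ (hnum R 1 1)); last exact: hnum_mono.
by rewrite hnumS hnum0 add0r expr1 /half_int -[leLHS]invr1 lef_pV2 ?posrE //; lra.
Qed.

Lemma cvg_EulerT p q : (1 < p)%N -> (1 < q)%N ->
  series (fun n => hnum R p n / half_int n ^+ q) @ \oo --> EulerT R p q.
Proof.
move=> p1 q1; apply: (@cvg_series_half_int q _ (ttilde R p)) => // n.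
rewrite ger0_norm ?hnum_ge0 // (le_trans (hnum_le_ttilde R n p1)) //.
rewrite ler_peMr ?hnum1_ge1 //.
by apply: le_trans (hnum_le_ttilde R 0 p1); exact: hnum_ge0.
Qed.

Lemma cvg_series_half_int_inv q : (1 < q)%N ->
  series (fun n => half_int n ^- q) @ \oo --> ttilde R q.
Proof.
move=> q1; have -> : series (fun n => half_int n ^- q) = hnum R q.
  by apply: funext => n; rewrite hnumE /series /= big_mkord.
exact: cvg_hnum.
Qed.

(** At [n + 1/2] the limits involve [h_{n+1}]; peeling off the last terms of [h_{n+1} h_{n+1}^{(p)}]
    yields [T_{1p,q}] with the lower sums. At [-(n + 1/2)] the product comes with [-(-1)^(p+q)],
    whence the parity factor. *)
Lemma lim_Gpair_lim p q : (1 < p)%N -> (1 < q)%N -> limn (series (Gpair_lim p q)) =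
  (1 - (-1) ^+ (p + q)) * EulerT1 R p q
  + (-1) ^+ p * ttilde R p * (1 + (-1) ^+ q) * EulerT R 1 q
  + (-1) ^+ p * ttilde R p * ttilde R (q + 1)
  + EulerT R 1 (p + q) + EulerT R p (q + 1) + ttilde R (p + q + 1).
Proof.
move=> p1 q1; apply: cvg_lim => //.
have -> : Gpair_lim p q = (fun n =>
  (1 - (-1) ^+ (p + q)) * (hnum R 1 n * hnum R p n / half_int n ^+ q)
  + (-1) ^+ p * ttilde R p * (1 + (-1) ^+ q) * (hnum R 1 n / half_int n ^+ q)
  + (-1) ^+ p * ttilde R p * (half_int n ^- (q + 1))
  + hnum R 1 n / half_int n ^+ (p + q) + hnum R p n / half_int n ^+ (q + 1)
  + half_int n ^- (p + q + 1)).
  apply: funext => n; rewrite /Gpair_lim !hnumS invXN !exprD !invfM !expr1.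
  ring.
repeat (apply: cvg_series_add).
- by apply: cvg_series_scale; exact: cvg_EulerT1.
- by apply: cvg_series_scale; exact: cvg_EulerT_1.
- by apply: cvg_series_scale; apply: cvg_series_half_int_inv; lia.
- by apply: cvg_EulerT_1; lia.
- by apply: cvg_EulerT; lia.
- by apply: cvg_series_half_int_inv; lia.
Qed.

Definition Bcoef_sum j r : R := if j is 0 then 2 * ln 2 * zeta R r + EulerS R 1 r
  else (-1) ^+ j * EulerS R j.+1 r - zeta R j.+1 * zeta R r.

Lemma cvg_series_inv q : (1 < q)%N ->
  series (fun n => n.+1%:R ^- q) @ \oo --> zeta R q.
Proof.
move=> q1; have -> : series (fun n => n.+1%:R ^- q) = Hnum R q.
  by apply: funext => n; rewrite HnumE /series /= big_mkord.
exact: cvg_Hnum.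
Qed.

Lemma cvg_EulerS p q : (0 < p)%N -> (1 < q)%N ->
  series (fun n => Hnum R p n.+1 / n.+1%:R ^+ q) @ \oo --> EulerS R p q.
Proof.
move=> p0 q1; apply: (series_dominated_cvg _ (@cvg_harmonic_dom R)) => n.
rewrite ger0_norm ?divr_ge0 ?Hnum_ge0 ?exprn_ge0 //.
apply: le_trans (invX_Hnum_harmonic_dom R n q1).
by rewrite ler_wpM2r ?Hnum_leHnum1 // invr_ge0 exprn_ge0.
Qed.

Lemma cvg_series_Bcoef_lim j r : (1 < r)%N ->
  series (fun n => Bcoef_lim j n.+1 * n.+1%:R ^- r) @ \oo --> Bcoef_sum j r.
Proof.
move=> r1; case: j => [|j].
  have -> : (fun n => Bcoef_lim 0 n.+1 * n.+1%:R ^- r) =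
    (fun n => 2 * ln 2 * n.+1%:R ^- r + Hnum R 1 n.+1 / n.+1%:R ^+ r).
    by apply: funext => n; rewrite mulrDl.
  apply: cvg_series_add; last exact: cvg_EulerS.
  by apply: cvg_series_scale; exact: cvg_series_inv.
have -> : (fun n => Bcoef_lim j.+1 n.+1 * n.+1%:R ^- r) =
  (fun n => (-1) ^+ j.+1 * (Hnum R j.+2 n.+1 / n.+1%:R ^+ r)
     + - zeta R j.+2 * n.+1%:R ^- r).
  by apply: funext => n; rewrite /Bcoef_lim; ring.
rewrite /Bcoef_sum -mulNr; apply: cvg_series_add.
  by apply: cvg_series_scale; exact: cvg_EulerS.
by apply: cvg_series_scale; exact: cvg_series_inv.
Qed.

Lemma lim_Gpart_lim p q : (1 < q)%N -> limn (series (fun n => Gpart_lim p q n.+1)) =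
  \sum_(i < p.+1) (-1) ^+ i * 'C((q + i).-1, i)%:R * tau R (p.+1 - i) * zeta R (q + i)
  + \sum_(j < p) \sum_(i < p - j)
      (-1) ^+ i * 'C((q + i).-1, i)%:R * tau R (p - j - i) * Bcoef_sum j (q + i).
Proof.
move=> q1; apply: cvg_lim => //.
have -> : (fun n => Gpart_lim p q n.+1) = (fun n =>
  \sum_(i < p.+1) (-1) ^+ i * 'C((q + i).-1, i)%:R * tau R (p.+1 - i) * n.+1%:R ^- (q + i)
  + \sum_(j < p) \sum_(i < p - j) (-1) ^+ i * 'C((q + i).-1, i)%:R * tau R (p - j - i)
      * (Bcoef_lim j n.+1 * n.+1%:R ^- (q + i))).
  apply: funext => n; congr (_ + _).
    by apply: eq_bigr => i _; rewrite /invX_coef; ring.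
  apply: eq_bigr => j _; rewrite mulr_sumr.
  by apply: eq_bigr => i _; rewrite /invX_coef; ring.
apply: cvg_series_add; apply: cvg_series_sum => i _.
  by apply: cvg_series_scale; apply: cvg_series_inv; lia.
apply: cvg_series_sum => j _; apply: cvg_series_scale.
by apply: cvg_series_Bcoef_lim; lia.
Qed.

End Identity.

(** * Rewriting the limits as the sums of the theorem *)

Section Reindex.
Variable R : realType.

Lemma tauS l : tau R l.+1 = (1 - (-1) ^+ l) * ttilde R (l + 1).
Proof. by rewrite /tau addn1 exprS mulN1r. Qed.

(** At most one [k] satisfies the constraint. None does when [Q - c] is odd or [Q <= c], and there
    [tau] vanishes too, by parity or by [tau 0 = 0]. *)
Lemma sum_even_tau Q c :
  2 * (\sum_(1 <= k < Q.+1 | (2 * k + c == Q)%N) ttilde R (2 * k)) = tau R (Q - c).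
Proof.
have [[k [k0 QE]]|nk] := pselect (exists k, (0 < k)%N /\ Q = (2 * k + c)%N).
  have kQ : k \in index_iota 1 Q.+1 by rewrite mem_index_iota; lia.
  rewrite big_mkcond (bigD1_seq k) ?iota_uniq //= {1}QE eqxx big1 ?addr0.
    rewrite QE addnK; case: k k0 {QE kQ} => // k _; rewrite /tau.
    by rewrite mulnS addSn -[(1 + _).+1]/(2 +
      2 * k)%N -mulnS exprM sqrrN expr1n expr1n; ring.
  by move=> j jk; rewrite ifF //; apply/negbTE/eqP; move: jk => /eqP; lia.
rewrite big_nat_cond big1 ?mulr0.
  case E : (Q - c)%N => [|m] //; rewrite tauS.
  suff -> : (-1) ^+ m = 1 :> R by rewrite subrr mul0r.
  rewrite -signr_odd; case mo : (odd m) => //; exfalso; apply: nk.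
  by exists (m.+1)./2; split; lia.
move=> k /andP[/andP[k1 _] /eqP kQ]; exfalso; apply: nk; exists k; split => //.
Qed.

Lemma sum_even_tau2 Q (F : nat -> R) :
  2 * (\sum_(1 <= k1 < Q.+1) \sum_(1 <= k2 < Q.+1 | (2 * k1 + k2 == Q)%N)
    ttilde R (2 * k1) * F k2) = \sum_(1 <= k < Q.+1) tau R (Q - k) * F k.
Proof.
rewrite (exchange_big_dep xpredT) //= mulr_sumr; apply: eq_bigr => k _.
by rewrite -mulr_suml mulrA sum_even_tau.
Qed.

Lemma sum_even_tau3 Q (F G : nat -> R) :
  2 * (\sum_(1 <= k1 < Q.+1) \sum_(1 <= k2 < Q.+1)
    \sum_(1 <= k3 < Q.+1 | (2 * k1 + k2 + k3 == Q)%N) ttilde R (2 * k1) * F k2 * G k3) =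
  \sum_(1 <= k2 < Q.+1) \sum_(1 <= k3 < Q.+1) tau R (Q - k2 - k3) * F k2 * G k3.
Proof.
rewrite exchange_big /= mulr_sumr; apply: eq_bigr => k2 _.
rewrite (exchange_big_dep xpredT) //= mulr_sumr; apply: eq_bigr => k3 _.
rewrite -mulr_suml -mulr_suml !mulrA -subnDA -sum_even_tau.
by under [in LHS]eq_bigl do rewrite -addnA.
Qed.

Lemma sum_tau_widen m a (F : nat -> R) : (m <= a)%N ->
  \sum_(l < a) F l * tau R (m - l) = \sum_(l < m) F l * tau R (m - l).
Proof.
move=> ma; rewrite -(subnKC ma) big_split_ord /= [X in _ + X]big1 ?addr0 // => i _.
have /eqP -> : (m - (m + i) == 0)%N by rewrite subn_eq0 leq_addr.
by rewrite mulr0.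
Qed.

Lemma signr_sub l m : (l <= m)%N -> (-1) ^+ (m - l) = (-1) ^+ m * (-1) ^+ l :> R.
Proof.
by move=> lm; rewrite -[in RHS](subnK lm) exprD -mulrA -expr2 sqrr_sign mulr1.
Qed.

(** Substitute [i = m - l], use the symmetry of binomials, and note
    [(-1)^l (1 - (-1)^l) = (-1)^l - 1]. *)
Lemma sum_principal m q (F : nat -> R) : (0 < q)%N ->
  \sum_(i < m.+1) (-1) ^+ i * 'C((q + i).-1, i)%:R * tau R (m.+1 - i) * F (q + i)%N
  = (-1) ^+ m * \sum_(0 <= l < m.+1) ((-1) ^+ l - 1) * 'C(m + q - l - 1, q - 1)%:R
      * ttilde R (l + 1) * F (m + q - l)%N.
Proof.
move=> q0; rewrite (reindex_inj rev_ord_inj) /= big_mkord mulr_sumr.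
apply: eq_bigr => l _; have lm : (l <= m)%N by rewrite -ltnS.
have -> : (m.+1 - l.+1 = m - l)%N by [].
have -> : (m.+1 - (m - l) = l.+1)%N by lia.
have -> : (q + (m - l) = m + q - l)%N by lia.
have -> : 'C((m + q - l).-1, m - l) = 'C(m + q - l - 1, q - 1).
  by rewrite -bin_sub; [congr 'C(_, _); lia|lia].
rewrite (signr_sub lm).
rewrite tauS; have : (-1) ^+ l * (-1) ^+ l = 1 :> R by rewrite -expr2 sqrr_sign.
move: ((-1) ^+ l) => e ee; rewrite -!mulrA; congr (_ * _).
transitivity ((e - e * e) * ('C(m + q - l - 1, q - 1)%:R * (ttilde R (l + 1) * F (m +
    q - l)%N))).
  by ring.
by rewrite ee.
Qed.

(** The four groups of [Lam_lim] expand the product of the two jets. In each sum over [beta_lim] the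
    index [0] gives the [log 2] term and the others the zeta values. *)
Lemma Lam_limE p q : (1 < p)%N -> (1 < q)%N -> Lam_lim R p q =
  (1 - (-1) ^+ (p + q)) * ttilde R (p + q + 1)
  + (1 + (-1) ^+ (p + q)) * 2 * ln 2 * ttilde R (p + q)
  - 2 * (\sum_(1 <= k1 < (p + q).+1)
           \sum_(1 <= k2 < (p + q).+1 | (2 * k1 + k2 == p + q)%N)
             ttilde R (2 * k1) * zeta R (k2 + 1))
  + (-1) ^+ p * 2 *
      (\sum_(1 <= k1 < (q + 2).+1)
         \sum_(1 <= k2 < (q + 2).+1 | (2 * k1 + k2 == q + 2)%N)
           'C(k2 + p - 2, p - 1)%:R * ttilde R (2 * k1) * zeta R (k2 + p - 1))
  + (-1) ^+ p * 4 * ln 2 *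
      (\sum_(1 <= k1 < (q + 1).+1)
         \sum_(1 <= k2 < (q + 1).+1 | (2 * k1 + k2 == q + 1)%N)
           'C(k2 + p - 2, p - 1)%:R * ttilde R (2 * k1) * zeta R (k2 + p - 1))
  - (-1) ^+ p * 2 *
      (\sum_(1 <= k1 < (q + 1).+1)
         \sum_(1 <= k2 < (q + 1).+1)
           \sum_(1 <= k3 < (q + 1).+1 | (2 * k1 + k2 + k3 == q + 1)%N)
             'C(k3 + p - 2, p - 1)%:R * ttilde R (2 * k1) * zeta R (k2 + 1)
               * zeta R (k3 + p - 1)).
Proof.
move=> p1 q1; pose D k : R := 'C(k + p - 2, p - 1)%:R * zeta R (k + p - 1).
have dE l : delta_lim R p l = (-1) ^+ p * D l.+1.
  rewrite /delta_lim /D -mulrA -bin_sub; last by lia.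
  by congr (_ * ('C(_, _)%:R * zeta R _)); lia.
have s2 Q : (0 < Q)%N -> 2 * (\sum_(1 <= k1 < Q.+1)
    \sum_(1 <= k2 < Q.+1 | (2 * k1 + k2 == Q)%N)
       'C(k2 + p - 2, p - 1)%:R * ttilde R (2 * k1) * zeta R (k2 + p - 1)) =
    \sum_(l < Q) D l.+1 * tau R (Q.-1 - l).
  move=> Q0; transitivity (\sum_(1 <= k < Q.+1) tau R (Q - k) * D k).
    rewrite -sum_even_tau2; congr (_ * _); apply: eq_bigr => k1 _.
    by apply: eq_bigr => k2 _; rewrite /D; ring.
  rewrite big_add1 /= big_mkord; apply: eq_bigr => l _; rewrite mulrC.
  by congr (_ * tau R _); lia.
have s3 : 2 * (\sum_(1 <= k1 < (q + 1).+1) \sum_(1 <= k2 < (q + 1).+1)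
     \sum_(1 <= k3 < (q + 1).+1 | (2 * k1 + k2 + k3 == q + 1)%N)
       'C(k3 + p - 2, p - 1)%:R * ttilde R (2 * k1) * zeta R (k2 + 1)
               * zeta R (k3 + p - 1)) =
    \sum_(i < q + 1) \sum_(l < q + 1) zeta R i.+2 * D l.+1 * tau R (q - i.+1 - l).
  transitivity (\sum_(1 <= k2 < (q + 1).+1) \sum_(1 <= k3 < (q + 1).+1)
      tau R (q + 1 - k2 - k3) * zeta R (k2 + 1) * D k3).
    rewrite -sum_even_tau3; congr (_ * _); apply: eq_bigr => k1 _.
    by apply: eq_bigr => k2 _; apply: eq_bigr => k3 _; rewrite /D; ring.
  rewrite big_add1 /= big_mkord; apply: eq_bigr => i _.
  rewrite big_add1 /= big_mkord; apply: eq_bigr => l _; rewrite (addn1 i.+1).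
  have -> : (q + 1 - i.+1 - l.+1 = q - i.+1 - l)%N by lia.
  by ring.
have s1 : 2 * (\sum_(1 <= k1 < (p + q).+1)
    \sum_(1 <= k2 < (p + q).+1 | (2 * k1 + k2 == p + q)%N)
      ttilde R (2 * k1) * zeta R (k2 + 1)) =
    \sum_(i < p + q) zeta R i.+2 * tau R (p + q - i.+1).
  rewrite (sum_even_tau2 _ (fun k => zeta R (k + 1))) big_add1 /= big_mkord.
  by apply: eq_bigr => i _; rewrite addn1 mulrC.
have z3 : \sum_(l < (p + q).+1) delta_lim R p l * tau R (q + 1 - l) =
    (-1) ^+ p * (\sum_(l < q + 2) D l.+1 * tau R ((q + 2).-1 - l)).
  rewrite (_ : (q + 2).-1 = (q + 1)%N); last by lia.
  rewrite (@sum_tau_widen _ _ (delta_lim R p)); last by lia.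
  rewrite (@sum_tau_widen _ _ (fun l => D l.+1)); last by lia.
  by rewrite [in RHS]mulr_sumr; apply: eq_bigr => l _; rewrite dE -[LHS]mulrA.
have wid i : \sum_(l < (p + q).+1) delta_lim R p l * tau R (q - i - l) =
    (-1) ^+ p * (\sum_(l < q + 1) D l.+1 * tau R (q - i - l)).
  rewrite (@sum_tau_widen _ _ (delta_lim R p)); last by lia.
  rewrite (@sum_tau_widen _ _ (fun l => D l.+1)); last by lia.
  by rewrite [in RHS]mulr_sumr; apply: eq_bigr => l _; rewrite dE -[LHS]mulrA.
have z4 : \sum_(i < (p + q).+1) \sum_(l < (p + q).+1)
      beta_lim R i * delta_lim R p l * tau R (q - i - l) =
    (-1) ^+ p * (2 * ln 2 * (\sum_(l < q + 1) D l.+1 * tau R ((q + 1).-1 - l))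
      - \sum_(i < q + 1) \sum_(l < q + 1) zeta R i.+2 * D l.+1 * tau R (q - i.+1 - l)).
  under eq_bigr => i _.
    under eq_bigr do rewrite -mulrA; rewrite -mulr_sumr wid; over.
  rewrite big_ord_recl /= subn0 addn1 /= mulrBr mulrCA; congr (_ + _).
  (* Cuts the range to that of the target sum; beyond it the argument of [tau] is [0]. *)
  have -> : (p + q = q.+1 + p.-1)%N by lia.
  rewrite big_split_ord /= [X in _ + X]big1 ?addr0; last first.
    move=> i _; rewrite [X in _ * (_ * X)]big1 ?mulr0 // => l _.
    have -> : (q - bump 0 (q.+1 + i) - l = 0)%N by rewrite /bump; lia.
    by rewrite mulr0.
  rewrite -mulrN -sumrN mulr_sumr; apply: eq_bigr => i _.
  rewrite /bump /= add1n mulrCA mulNr mulr_sumr; congr (_ * - _).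
  by apply: eq_bigr => l _; rewrite mulrA.
have z2 : \sum_(i < (p + q).+1) beta_lim R i * tau R (p + q - i) =
    (1 + (-1) ^+ (p + q)) * 2 * ln 2 * ttilde R (p + q)
    - \sum_(i < p + q) zeta R i.+2 * tau R (p + q - i.+1).
  rewrite big_ord_recl /= subn0; congr (_ + _).
    have -> : tau R (p + q) = (1 + (-1) ^+ (p + q)) * ttilde R (p + q).
      by rewrite /tau; case: (p + q)%N (ltn_addr q (ltnW p1)).
    by ring.
  by rewrite -sumrN; apply: eq_bigr => i _; rewrite /bump /= add1n mulNr.
rewrite /Lam_lim tauS z2 z3 z4 -s1 -s3 -!s2; [ring|lia|lia].
Qed.

End Reindex.

Local Close Scope classical_set_scope.

Theorem theorem2p7 (R : realType) (p q : nat) (hp : (1 < p)%N) (hq : (1 < q)%N) :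
  (1 - (-1) ^+ (p + q)) * EulerT1 R p q =
  - (-1) ^+ p * (1 + (-1) ^+ q) * ttilde R p * EulerT R 1 q
  - (-1) ^+ p * ttilde R p * ttilde R (q + 1)
  - EulerT R 1 (p + q)
  - EulerT R p (q + 1)
  - (-1) ^+ (p + q) * ttilde R (p + q + 1)
  + (1 + (-1) ^+ (p + q)) * 2 * ln 2 * ttilde R (p + q)
  - 2 * (\sum_(1 <= k1 < (p + q).+1)
           \sum_(1 <= k2 < (p + q).+1 | (2 * k1 + k2 == p + q)%N)
             ttilde R (2 * k1) * zeta R (k2 + 1))
  + (-1) ^+ p * 2 *
      (\sum_(1 <= k1 < (q + 2).+1)
         \sum_(1 <= k2 < (q + 2).+1 | (2 * k1 + k2 == q + 2)%N)
           'C(k2 + p - 2, p - 1)%:R * ttilde R (2 * k1) * zeta R (k2 + p - 1))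
  + (-1) ^+ p * 4 * ln 2 *
      (\sum_(1 <= k1 < (q + 1).+1)
         \sum_(1 <= k2 < (q + 1).+1 | (2 * k1 + k2 == q + 1)%N)
           'C(k2 + p - 2, p - 1)%:R * ttilde R (2 * k1) * zeta R (k2 + p - 1))
  - (-1) ^+ p * 2 *
      (\sum_(1 <= k1 < (q + 1).+1)
         \sum_(1 <= k2 < (q + 1).+1)
           \sum_(1 <= k3 < (q + 1).+1 | (2 * k1 + k2 + k3 == q + 1)%N)
             'C(k3 + p - 2, p - 1)%:R * ttilde R (2 * k1) * zeta R (k2 + 1)
               * zeta R (k3 + p - 1))
  + (-1) ^+ p *
      (\sum_(0 <= l < p.+1)
         ((-1) ^+ l - 1) * 'C(p + q - l - 1, q - 1)%:R * ttilde R (l + 1)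
           * zeta R (p + q - l))
  - (-1) ^+ p *
      (\sum_(0 <= l < p)
         ((-1) ^+ l - 1) * 'C(p + q - l - 2, q - 1)%:R * ttilde R (l + 1)
           * (EulerS R 1 (p + q - l - 1) + 2 * ln 2 * zeta R (p + q - l - 1)))
  + (-1) ^+ p *
      (\sum_(1 <= k < p)
         (-1) ^+ (k + 1) *
         \sum_(0 <= l < p - k)
           ((-1) ^+ l - 1) * 'C(p + q - k - l - 2, q - 1)%:R * ttilde R (l + 1)
             * ((-1) ^+ k * EulerS R (k + 1) (p + q - k - l - 1)
                - zeta R (k + 1) * zeta R (p + q - k - l - 1))).
Proof.
have := lim_Gpair_lim R hp hq; rewrite lim_series_Gpair_lim // lim_Gpart_lim // Lam_limE //.
rewrite (sum_principal _ (zeta R)); last by lia.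
have -> : \sum_(j < p) \sum_(i < p - j)
      (-1) ^+ i * 'C((q + i).-1, i)%:R * tau R (p - j - i) * Bcoef_sum R j (q + i) =
  - (-1) ^+ p *
      (\sum_(0 <= l < p)
         ((-1) ^+ l - 1) * 'C(p + q - l - 2, q - 1)%:R * ttilde R (l + 1)
           * (EulerS R 1 (p + q - l - 1) + 2 * ln 2 * zeta R (p + q - l - 1)))
  + (-1) ^+ p *
      (\sum_(1 <= k < p)
         (-1) ^+ (k + 1) *
         \sum_(0 <= l < p - k)
           ((-1) ^+ l - 1) * 'C(p + q - k - l - 2, q - 1)%:R * ttilde R (l + 1)
             * ((-1) ^+ k * EulerS R (k + 1) (p + q - k - l - 1)
                - zeta R (k + 1) * zeta R (p + q - k - l - 1))).
  (* The index [j = 0], where [Bcoef_sum] carries [log 2] and [S_{1,r}], gives the single sum; each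
     [j = k >= 1] gives one term of the sum over [k]. *)
  case: p hp => // r _; rewrite big_ord_recl subn0 sum_principal; last by lia.
  congr (_ + _).
    rewrite exprS mulN1r opprK; congr (_ * _); apply: eq_big_nat => l /andP[_ lr].
    rewrite (_ : (r.+1 + q - l - 2 = r + q - l - 1)%N); last by lia.
    rewrite (_ : (r.+1 + q - l - 1 = r + q - l)%N); last by lia.
    by rewrite /Bcoef_sum [X in _ * X]addrC.
  rewrite big_add1 /= big_mkord mulr_sumr; apply: eq_bigr => k _ /=.
  rewrite /bump add1n; have kr := ltn_ord k.
  have -> : (r.+1 - k.+1 = (r - k.+1).+1)%N by lia.
  rewrite (@sum_principal R (r - k.+1) q (Bcoef_sum R k.+1)); last by lia.
  rewrite mulrA; congr (_ * _).
    have kr' : (k.+2 <= r.+1)%N by [].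
    by have := signr_sub R kr'; rewrite subSS addn1.
  apply: eq_big_nat => l /andP[_ lr].
  rewrite (_ : (r.+1 + q - k.+1 - l - 2 = r - k.+1 + q - l - 1)%N); last by lia.
  rewrite (_ : (r.+1 + q - k.+1 - l - 1 = r - k.+1 + q - l)%N); last by lia.
  by rewrite (addn1 k.+1).
(* The pole of order [p + q + 1] at [0] contributes [(1 - (-1)^(p+q)) ttilde (p+q+1)]; moving the
   [ttilde (p+q+1)] of the half-integer side across leaves the coefficient [-(-1)^(p+q)]. *)
lra.
Qed.
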